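(* Let $(X,d,\mu,\mathcal{E},\mathcal{F})$ be a Dirichlet space satisfying the standing assumptions (A1)–(A3), (HK), (BE) stated in the context, and let $0<\delta<1$. Assume $\alpha_1^{\#}=1$. Then there exists a constant $C>0$ such that for every $f\in\mathbf{B}^{1,1}(X)$ and every $t>0$, $$\|P^{(\delta)}_tf-f\|_{L^1(X,\mu)}\le C\,t\int_X\int_X\frac{|f(x)-f(y)|}{d(x,y)^{d_H+\delta d_W}}\,d\mu(y)\,d\mu(x).$$
   Context: Setting. $(X,d,\mu)$ is a locally compact metric measure space, $\mu$ a Radon measure supported on $X$, and $(\mathcal{E},\mathcal{F})$ is a Dirichlet form on $L^2(X,\mu)$ with heat semigroup $\{P_t\}_{t>0}$ and generator $L$. Write $B(x,r)=\{y: d(x,y)<r\}$. For $\lambda>0$, $1\le p<\infty$, $KS^{\lambda,p}(X)$ is the set of $f\in L^p(X,\mu)$ with $\limsup_{r\to0^+}\int_X\int_{B(x,r)}\frac{|f(x)-f(y)|^p}{r^{\lambda p}\mu(B(x,r))}d\mu(y)d\mu(x)<\infty$. Standing assumptions. (A1) Every ball $B(x,r)$ has compact closure. (A2) There are $c_1,c_2,d_H>0$ with $c_1r^{d_H}\le\mu(B(x,r))\le c_2r^{d_H}$ for all $x\in X$, $r\ge0$. (A3) $(\mathcal{E},\mathcal{F})$ is regular and strongly local. (HK) $\{P_t\}$ has a continuous heat kernel $p_t(x,y)$ and there are $c_3,c_4,c_5,c_6\in(0,\infty)$, $d_W\in[2,\infty)$ with $c_5t^{-d_H/d_W}\exp(-c_6(d(x,y)^{d_W}/t)^{1/(d_W-1)})\le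 p_t(x,y)\le c_3t^{-d_H/d_W}\exp(-c_4(d(x,y)^{d_W}/t)^{1/(d_W-1)})$ for $\mu\times\mu$-a.e. $(x,y)$ and every $t>0$. (BE) There is $C>0$ such that $|P_tg(x)-P_tg(y)|\le C\frac{d(x,y)^\kappa}{t^{\kappa/d_W}}\|g\|_{L^\infty(X,\mu)}$ for all $t>0$, $g\in L^\infty(X,\mu)$, $x,y\in X$, where $0<\kappa<d_W$ is defined by $d_W-\kappa=\sup\{\lambda>0: KS^{\lambda,1}(X)\text{ contains non-constant functions}\}$. Subordinated semigroup. For fixed $0<\delta<1$ let $\eta^{(\delta)}_t\ge0$ be the continuous function with $\int_0^\infty\eta^{(\delta)}_t(s)e^{-s\lambda}ds=e^{-t\lambda^\delta}$ for $\lambda>0$. The semigroup with generator given by the fractional Laplacian $(-L)^\delta$ is $P^{(\delta)}_tf=\int_0^\infty\eta^{(\delta)}_t(s)P_sf\,ds$, with heat kernel $p^{(\delta)}_t(x,y)=\int_0^\infty\eta^{(\delta)}_t(s)p_s(x,y)ds$. Besov classes. For $p\ge1$, $\alpha\ge0$: $\|f\|_{p,\alpha}=\sup_{t>0}t^{-\alpha}\left(\int_X\int_X|f(x)-f(y)|^pp^{(\delta)}_t(x,y)d\mu(x)d\mu(y)\right)^{1/p}$ and $\mathbf{B}^{p,\alpha}(X)=\{f\in L^p(X,\mu):\|f\|_{p,\alpha}<\infty\}$. The $L^1$ critical exponent is $\alpha_1^{\#}=\sup\{\alpha>0:\mathbf{B}^{1,\alpha}(X)\text{ contains non-constant functions}\}$;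 the condition $\alpha_1^{\#}=1$ is equivalent to $\delta\le1-\frac{\kappa}{d_W}$. *)

(* Defs.v *)
From HB Require Import structures.
From mathcomp Require Import all_boot all_order all_algebra.
From mathcomp Require Import all_classical all_reals all_analysis.

Set Implicit Arguments.
Unset Strict Implicit.
Unset Printing Implicit Defensive.

Import Order.TTheory GRing.Theory Num.Theory.
Import numFieldNormedType.Exports.

Local Open Scope classical_set_scope.
Local Open Scope ring_scope.

(* A metric space with a distinguished point: measurable types are pointed in
   the library, so a Borel sigma-algebra needs a nonempty carrier. *)
#[short(type="pmetricType")]
HB.structure Definition PointedMetric (K : numDomainType) :=
  { M of Pointed M & Metric K M }.

Notation borel X := (g_sigma_algebraType (@open X)).

Section metric_measure_space.
Context (R : realType) (X : pmetricType R).
Variable mu : {measure set (borel X) -> \bar R}.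

Definition radon_measure : Prop :=
  [/\ forall K : set X, compact K -> (mu K < +oo)%E,
      forall A : set (borel X), measurable A ->
        mu A = ereal_inf [set mu U | U in [set U : set X | open U /\ A `<=` U]]
    & forall U : set X, open U ->
        mu U = ereal_sup [set mu K | K in [set K : set X | compact K /\ K `<=` U]]].

Definition full_support : Prop :=
  forall U : set X, open U -> U !=set0 -> (0 < mu U)%E.

Definition relatively_compact_balls : Prop :=
  forall (x : X) (r : R), compact (closure (ball x r)).

Definition ahlfors_regular (dH : R) : Prop :=
  exists c1 c2 : R, [/\ 0 < c1, 0 < c2 &
    forall (x : X) (r : R), 0 <= r ->
      ((c1 * r `^ dH)%:E <= mu (ball x r) <= (c2 * r `^ dH)%:E)%E].

(* Elements of L^p are represented by measurable functions; equality in L^p is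
   equality mu-almost everywhere. *)
Definition contains_nonconstant (S : set (X -> R)) : Prop :=
  exists2 f : X -> R, S f & ~ exists c : R, {ae mu, forall x, f x = c}.

(* mu (ball x r) is finite and nonzero for 0 < r under Ahlfors regularity, so
   that fine loses nothing where this is used. *)
Definition ks_energy (lambda p : R) (f : X -> R) (r : R) : \bar R :=
  (\int[mu]_x \int[mu]_(y in ball x r)
    (`|f x - f y| `^ p / (r `^ (lambda * p) * fine (mu (ball x r))))%:E)%E.

Definition KS (lambda p : R) : set (X -> R) :=
  [set f | (f : borel X -> R) \in Lfun mu p%:E /\
           (limf_esup (ks_energy lambda p f) 0^'+ < +oo)%E].

End metric_measure_space.

Section dirichlet_form.
Context (R : realType) (X : pmetricType R).
Variable mu : {measure set (borel X) -> \bar R}.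

Definition L2 : set (X -> R) := [set f | (f : borel X -> R) \in Lfun mu 2%:E].

Definition L2norm (f : X -> R) : \bar R := 'N[mu]_2%:E[EFin \o f]%E.

Definition L2inner (f g : X -> R) : R := \int[mu]_x (f x * g x).

Definition compactly_supported_continuous : set (X -> R) :=
  [set f | continuous f /\ compact (closure [set x | f x != 0])].

(* The support of the (signed) measure u mu, which depends only on the class of
   u modulo mu-a.e. equality. *)
Definition ess_support (u : X -> R) : set X :=
  [set x | forall U : set X, open U -> U x ->
    ~ mu.-negligible (U `&` [set y | u y != 0])].

Variables (E : (X -> R) -> (X -> R) -> R) (F : set (X -> R)).

Definition E1 (u v : X -> R) : R := E u v + L2inner u v.

(* F is a space of representatives: it is saturated under, and E is compatible
   with, mu-a.e. equality. *)
Record dirichlet_form : Prop := {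
  form_domain_sub : F `<=` L2 ;
  form_domain_ae : forall u v, F u -> L2 v ->
    {ae mu, forall x, u x = v x} -> F v ;
  form_domain0 : F (cst 0) ;
  form_domain_lin : forall (a : R) u v, F u -> F v ->
    F (fun x => a * u x + v x) ;
  form_domain_dense : forall f, L2 f -> forall e : R, 0 < e ->
    exists2 u, F u & (L2norm (fun x => f x - u x)%R < e%:E)%E ;
  form_ae : forall u v w, F u -> F v -> F w ->
    {ae mu, forall x, u x = v x} -> E u w = E v w ;
  form_sym : forall u v, F u -> F v -> E u v = E v u ;
  form_lin : forall (a : R) u v w, F u -> F v -> F w ->
    E (fun x => a * u x + v x) w = a * E u w + E v w ;
  form_ge0 : forall u, F u -> 0 <= E u u ;
  form_closed : forall u : nat -> X -> R, (forall n, F (u n)) ->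
    (forall e : R, 0 < e -> exists N : nat, forall m n : nat,
      (N <= m)%N -> (N <= n)%N ->
      E1 (fun x => u m x - u n x) (fun x => u m x - u n x) < e) ->
    exists2 v, F v &
      E1 (fun x => u n x - v x) (fun x => u n x - v x) @[n --> \oo] --> 0 ;
  form_markov : forall u, F u ->
    let v := fun x => Num.min (Num.max (u x) 0) 1 in
    F v /\ E v v <= E u u
}.

Definition regular_form : Prop :=
  (forall u, F u -> forall e : R, 0 < e ->
    exists v, [/\ F v, compactly_supported_continuous v &
      E1 (fun x => u x - v x) (fun x => u x - v x) < e]) /\
  (forall f, compactly_supported_continuous f -> forall e : R, 0 < e ->
    exists v, [/\ F v, compactly_supported_continuous v &
      forall x, `|f x - v x| < e]).

Definition strongly_local_form : Prop :=
  forall u v, F u -> F v ->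
    compact (ess_support u) -> compact (ess_support v) ->
    (exists (U : set X) (c : R), [/\ open U, ess_support u `<=` U &
      {ae mu, forall x, U x -> v x = c}]) ->
    E u v = 0.

(* w = L u, where -L is the nonnegative self-adjoint operator of the form. *)
Definition form_generator (u w : X -> R) : Prop :=
  [/\ F u, L2 w & forall v, F v -> E u v = - L2inner w v].

Variable P : R -> (X -> R) -> X -> R.

Record contraction_semigroup : Prop := {
  semigroup_L2 : forall t f, 0 < t -> L2 f -> L2 (P t f) ;
  semigroup_lin : forall t (a : R) f g, 0 < t -> L2 f -> L2 g ->
    {ae mu, forall x, P t (fun y => a * f y + g y) x = a * P t f x + P t g x} ;
  semigroup_contraction : forall t f, 0 < t -> L2 f ->
    (L2norm (P t f) <= L2norm f)%E ;
  semigroup_add : forall s t f, 0 < s -> 0 < t -> L2 f ->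
    {ae mu, forall x, P (s + t) f x = P s (P t f) x} ;
  semigroup_cont : forall f, L2 f ->
    L2norm (fun x => P t f x - f x) @[t --> 0^'+] --> 0%E
}.

Definition infinitesimal_generator (u w : X -> R) : Prop :=
  [/\ L2 u, L2 w &
    L2norm (fun x => t^-1 * (P t u x - u x) - w x) @[t --> 0^'+] --> 0%E].

Definition heat_semigroup : Prop :=
  contraction_semigroup /\
  forall u w, infinitesimal_generator u w <-> form_generator u w.

End dirichlet_form.

Section heat_kernel.
Context (R : realType) (X : pmetricType R).
Variables (mu : {measure set (borel X) -> \bar R}) (p : R -> X -> X -> R).

(* The extension of the heat semigroup to L^q, 1 <= q <= +oo *)
Definition heat_op (t : R) (f : X -> R) (x : X) : R :=
  \int[mu]_y (p t x y * f y).

Definition continuous_heat_kernel (P : R -> (X -> R) -> X -> R) : Prop :=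
  forall t : R, 0 < t ->
    continuous (fun z : X * X => p t z.1 z.2) /\
    forall f, L2 mu f -> {ae mu, forall x, P t f x = heat_op t f x}.

Definition sub_gaussian (dH dW c c' t : R) (x y : X) : R :=
  c * t `^ (- dH / dW) *
  expR (- c' * (mdist x y `^ dW / t) `^ (1 / (dW - 1))).

Definition heat_kernel_estimates (dH dW : R) : Prop :=
  exists c3 c4 c5 c6 : R, [/\ 0 < c3, 0 < c4, 0 < c5, 0 < c6 &
    forall t : R, 0 < t ->
      {ae (mu \x mu)%E, forall z : borel X * borel X,
        sub_gaussian dH dW c5 c6 t z.1 z.2 <= p t z.1 z.2
          <= sub_gaussian dH dW c3 c4 t z.1 z.2}].

Definition bakry_emery (dW kappa : R) : Prop :=
  exists2 C : R, 0 < C &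
    forall (t : R) (g : X -> R) (x y : X), 0 < t ->
      (g : borel X -> R) \in Lfun mu +oo%E ->
      (`|heat_op t g x - heat_op t g y|%:E <=
        (C * (mdist x y `^ kappa / t `^ (kappa / dW)))%:E *
        'N[mu]_+oo[EFin \o g])%E.

(* The density at time t of the subordinator with Laplace exponent
   lambda |-> lambda^delta. *)
Definition subordinator_density (delta : R) (eta : R -> R -> R) : Prop :=
  forall t : R, 0 < t ->
  [/\ {within `]0, +oo[, continuous (eta t)},
      forall s, 0 < s -> 0 <= eta t s &
      forall l : R, 0 < l ->
        (\int[lebesgue_measure]_(s in `]0%R, +oo[) (eta t s * expR (- (s * l)))%:E
         = (expR (- (t * l `^ delta)))%:E)%E].

Variable eta : R -> R -> R.

Definition sub_heat_op (t : R) (f : X -> R) (x : X) : R :=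
  \int[lebesgue_measure]_(s in `]0, +oo[) (eta t s * heat_op s f x).

Definition sub_heat_kernel (t : R) (x y : X) : \bar R :=
  (\int[lebesgue_measure]_(s in `]0%R, +oo[) (eta t s * p s x y)%:E)%E.

Definition besov_seminorm (q alpha : R) (f : X -> R) : \bar R :=
  ereal_sup [set ((t `^ (- alpha))%:E *
    (\int[mu]_y \int[mu]_x
      ((`|f x - f y| `^ q)%:E * sub_heat_kernel t x y)) `^ q^-1)%E
  | t in [set t : R | 0 < t]].

Definition besov (q alpha : R) : set (X -> R) :=
  [set f | (f : borel X -> R) \in Lfun mu q%:E /\
           (besov_seminorm q alpha f < +oo)%E].

Definition critical_exponent1 : \bar R :=
  ereal_sup [set alpha%:E | alpha in
    [set alpha : R | 0 < alpha /\ contains_nonconstant mu (besov 1 alpha)]].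

End heat_kernel.

(* Main.v *)
Require Import Defs.
From HB Require Import structures.
From mathcomp Require Import all_boot all_order all_algebra.
From mathcomp Require Import all_classical all_reals all_analysis.
From mathcomp Require Import measurable_realfun ess_sup_inf.
From mathcomp Require Import ring lra.

Set Implicit Arguments.
Unset Strict Implicit.
Unset Printing Implicit Defensive.

Import Order.TTheory GRing.Theory Num.Theory.
Import numFieldNormedType.Exports.

Local Open Scope classical_set_scope.
Local Open Scope ring_scope.

(** Conservativeness, that is P_s 1 = 1, gives
<<
  P^(delta)_t f (x) - f (x)
    = \int_0^oo eta_t(s) \int_X p_s(x, y) (f(y) - f(x)) dmu(y) ds,
>>
at every x where the right-hand side converges absolutely, so the theorem
follows by integrating in x from the off-diagonal bound
<<
  \int_0^oo eta_t(s) p_s(x, y) ds <= A t d(x, y)^-(dH + delta dW).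
>>

The off-diagonal bound only involves the Laplace transform of eta_t.  The
stretched exponential in the upper heat kernel estimate absorbs any power, so
p_s(x, y) <= A d^(-dH) (1 - exp (- s d^(-dW))) with d = d(x, y)
([sub_gaussian_le_laplace]), and for l = d^(-dW) the integral of
eta_t(s) (1 - exp (- s l)) is 1 - exp (- t l^delta) <= t l^delta
([subordinator_laplace_increment]).

Conservativeness comes from the Bakry-Emery estimate.  By the two-sided heat
kernel estimate u_t = P_t 1 lies between two positive constants independent of
t, and by the Bakry-Emery estimate it oscillates by at most
C d(x, y)^kappa t^(-kappa/dW).  Averaging against p_s(x, .), whose kappa-th
moment is of order s^(kappa/dW), turns the semigroup law into
<<
  u_(s + t)(x) = P_s u_t (x) = u_s(x) u_t(x) + O((s / t)^(kappa/dW)).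
>>
Hence u_(n s)(x), n = 1, 2, ..., is asymptotically geometric with ratio u_s(x);
as it stays between two positive constants, the ratio is 1
([heat_op_conservative]).

The heat kernel is continuous in space for each time, so the iterated integrals
have to be justified in the time variable.  Tonelli's theorem is applied to the
explicit majorant above, which is jointly measurable.  That s |-> P_s f (x) is
measurable follows for bounded f from its continuity, as conservativeness and the
Bakry-Emery estimate make it locally Hoelder continuous
([heat_op_time_regular]), and for integrable f by truncation. *)

(** * Elementary inequalities and sequences *)

Section elementary.
Context {R : realType}.
Implicit Types (q c g u v : R).

(** For large [v] the factor [v `^ q] is at most [(v `^ g) ^+ n.+1] as soon as
    [q / g <= n.+1], and [x ^+ n.+1 / n.+1`! <= expR x] at [x = c * v `^ g]. *)
Lemma powR_mul_expRN_bounded q c g : 0 <= q -> 0 < c -> 0 < g ->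
  exists2 K : R, 0 < K &
    forall v, 0 <= v -> (1 + v) `^ q * expR (- c * v `^ g) <= K.
Proof.
move=> q0 c0 g0.
have [n qn] : exists n : nat, q / g <= n.+1%:R.
  exists (Num.bound (q / g)); apply: ltW.
  apply: (lt_le_trans (archi_boundP _)); first by rewrite divr_ge0// ltW.
  by rewrite ler_nat.
set B : R := n.+1`!%:R / c ^+ n.+1.
have B0 : 0 < B by rewrite divr_gt0 ?exprn_gt0// ltr0n fact_gt0.
exists (2 `^ q * (1 + B)) => [|v v0].
  by rewrite mulr_gt0 ?powR_gt0 ?addr_gt0.
have [v1|v1] := leP v 1.
  apply: ler_pM; rewrite ?powR_ge0 ?expR_ge0//.
    by apply: ge0_ler_powR => //; rewrite ?nnegrE; lra.
  apply: (@le_trans _ _ 1); last by lra.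
  by rewrite expR_le1 mulNr oppr_le0 mulr_ge0 ?powR_ge0// ltW.
have w1 : 1 <= v `^ g by rewrite -(powRr0 v) ler_powR// ltW.
apply: (@le_trans _ _ (2 `^ q * (v `^ g) ^+ n.+1 * expR (- c * v `^ g))).
  rewrite ler_wpM2r ?expR_ge0//.
  apply: (@le_trans _ _ ((2 * v) `^ q)).
    by apply: ge0_ler_powR => //; rewrite ?nnegrE; lra.
  rewrite powRM ?(ltW (lt_trans _ v1))// ler_wpM2l ?powR_ge0//.
  rewrite -[X in v `^ X](@divfK _ g) ?gt_eqF// mulrC powRrM -powR_mulrn ?powR_ge0//.
  by rewrite ler_powR.
rewrite -mulrA ler_wpM2l ?powR_ge0//.
apply: (@le_trans _ _ B); last by rewrite lerDr.
have cw0 : 0 <= c * v `^ g by rewrite mulr_ge0 ?powR_ge0// ltW.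
have := expR_ge1Dxn n cw0.
rewrite mulNr expRN ler_pdivrMr ?expR_gt0// => h.
rewrite -[leLHS](_ : B * ((c * v `^ g) ^+ n.+1 / n.+1`!%:R) = _).
  by rewrite ler_pM2l//; apply: le_trans h; rewrite lerDr.
rewrite /B exprMn; field.
by rewrite expf_neq0 ?gt_eqF//= pnatr_eq0 -lt0n fact_gt0.
Qed.

(** Equivalent to [1 + 1/u <= exp (1/u)]. *)
Lemma inv1D_le_1BexpRN u : 0 < u -> (1 + u)^-1 <= 1 - expR (- u^-1).
Proof.
move=> u0; have u0' : 0 < u^-1 by rewrite invr_gt0.
have := expR_ge1Dx u^-1; rewrite -lef_pV2 ?posrE ?expR_gt0 ?addr_gt0// -expRN.
suff -> : (1 + u^-1)^-1 = 1 - (1 + u)^-1 by lra.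
by field; rewrite !gt_eqF//= addr_gt0.
Qed.

Lemma bounded_increment_contra (b : nat -> R) (M c : R) (N : nat) : 0 < c ->
  (forall n, b n <= M) -> (forall n, (N <= n)%N -> c <= b n.+1 - b n) -> False.
Proof.
move=> c0 bM bc.
have h k : b N + c * k%:R <= b (N + k)%N.
  elim: k => [|k IH]; first by rewrite mulr0 addr0 addn0.
  have := bc (N + k)%N (leq_addr _ _); rewrite -addnS addnS -natr1 mulrDr mulr1.
  lra.
have [k hk] : exists k : nat, (M - b N) / c < k%:R.
  exists (Num.bound ((M - b N) / c)); apply: archi_boundP.
  by rewrite divr_ge0 ?(ltW c0)// subr_ge0.
move: hk; rewrite ltr_pdivrMr// => hk.
have := h k; have := bM (N + k)%N; lra.
Qed.

(** Up to a vanishing error the increments of [a] are [(m - 1) * a n], and [a]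
    stays away from zero: a ratio other than 1 would make [a] drift linearly out
    of its bounds. *)
Lemma quasi_geometric_ratio_eq1 (a e : nat -> R) (m m1 m2 : R) : 0 < m1 ->
  (forall n, m1 <= a n <= m2) -> e @ \oo --> 0 ->
  (forall n, `|a n.+1 - m * a n| <= e n) -> m = 1.
Proof.
move=> m10 am e0 ae.
have near_e (c : R) : 0 < c -> exists N, forall n, (N <= n)%N -> e n <= c.
  move=> c0; have [N _ h] : \forall n \near \oo, `|0 - e n| <= c.
    by move/cvgrPdist_le : e0; apply.
  exists N => n /h /=; rewrite sub0r normrN; exact: le_trans (ler_norm _).
apply/eqP; rewrite eq_le !leNgt; apply/andP; split; apply/negP => m_neq1.
- have c0 : 0 < (m - 1) * m1 / 2 by rewrite divr_gt0 ?mulr_gt0// subr_gt0.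
  have [N hN] := near_e _ c0.
  apply: (@bounded_increment_contra a m2 _ N c0) => [n|n /hN en].
    by case/andP : (am n).
  have /andP[h _] := am n; have := ae n; rewrite ler_norml => /andP[h1 _].
  have : (m - 1) * m1 <= (m - 1) * a n by rewrite ler_wpM2l// subr_ge0 ltW.
  nra.
- have c0 : 0 < (1 - m) * m1 / 2 by rewrite divr_gt0 ?mulr_gt0// subr_gt0.
  have [N hN] := near_e _ c0.
  apply: (@bounded_increment_contra (fun n => - a n) (- m1) _ N c0) => [n|n /hN en].
    by rewrite lerN2; case/andP : (am n).
  have /andP[h _] := am n; have := ae n; rewrite ler_norml => /andP[_ h1].
  have : (1 - m) * m1 <= (1 - m) * a n by rewrite ler_wpM2l// subr_ge0 ltW.
  nra.
Qed.

(** The smallest dyadic radius exceeding [v] is at most twice [1 + v], which costs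
    the factor [2 `^ M].  This dominates a power decay by a sum of indicators of
    balls. *)
Lemma dyadic_domination (M v : R) : 0 <= M -> 0 <= v -> exists2 k : nat,
  v < 2 ^+ k & (1 + v) `^ (- M) <= 2 `^ M * (2 ^+ k) `^ (- M).
Proof.
move=> M0 v0.
have two_gt (k : nat) : 0 < 2 ^+ k :> R by rewrite exprn_gt0.
have ex : exists k : nat, v < 2 ^+ k.
  exists (Num.bound v); apply: (lt_trans (archi_boundP v0)).
  by rewrite -natrX ltr_nat ltn_expl.
case: (ex_minnP ex) => k vk kmin; exists k => //.
case: k vk kmin => [_ _|k vk kmin].
  rewrite expr0 powR1 mulr1 (@le_trans _ _ 1)//.
    by rewrite -[leRHS](powRr0 (1 + v)) ler_powR ?oppr_le0// lerDl.
  by rewrite -[leLHS](powRr0 2) ler_powR// ler1n.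
have kv : 2 ^+ k <= v by rewrite leNgt; apply/negP => /kmin; rewrite ltnn.
rewrite exprS powRM ?(ltW (two_gt _))// mulrA -powRD; last by rewrite pnatr_eq0 implybT.
rewrite subrr powRr0 mul1r !powRN lef_pV2 ?posrE ?powR_gt0//; last by lra.
by apply: ge0_ler_powR; rewrite ?nnegrE ?(ltW (two_gt _))//; lra.
Qed.

End elementary.

(** * Comparison of integrals of arbitrary nonnegative functions *)

Section integral_monotone.
Context d (T : measurableType d) (R : realType).
Variable mu : {measure set T -> \bar R}.
Local Open Scope ereal_scope.

Import HBNNSimple.

(** The integral of a nonnegative function is a supremum over simple minorants,
    so comparison against a scaled function holds for arbitrary, possibly
    non-measurable functions. *)
Lemma ge0_le_integralZ (c : R) (f g : T -> \bar R) : (0 < c)%R ->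
  (forall x, 0 <= f x) -> (forall x, 0 <= g x) ->
  (forall x, f x <= c%:E * g x) ->
  \int[mu]_x f x <= c%:E * \int[mu]_x g x.
Proof.
move=> c0 f0 g0 fg; rewrite ge0_integralTE//.
apply: ub_ereal_sup => _ [h hf <-].
have c'0 : (0 <= c^-1)%R by rewrite invr_ge0 ltW.
pose h' := scale_nnsfun h c'0.
suff : sintegral mu h' <= \int[mu]_x g x.
  rewrite sintegralrM -(@lee_pmul2l _ c%:E)// ?lte_fin//.
  by rewrite muleA -EFinM mulfV ?gt_eqF// mul1e.
rewrite [leRHS]ge0_integralTE//; apply: ereal_sup_ubound; exists h' => // x /=.
rewrite -(@lee_pmul2l _ c%:E) ?lte_fin// -EFinM mulrA mulfV ?gt_eqF// mul1r.
exact: le_trans (hf x) (fg x).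
Qed.

End integral_monotone.

(** * Borel structure of a metric space *)

Section metric_borel.
Context {R : realType} {X : pmetricType R}.
Implicit Types (x y z : X) (r : R).

Lemma mdist_ler_norm x y x' y' :
  `|mdist x y - mdist x' y'| <= mdist x x' + mdist y y'.
Proof.
have h1 := metric_triangle x x' y; have h2 := metric_triangle x' y' y.
have h3 := metric_triangle x' x y'; have h4 := metric_triangle x y y'.
have e1 := metric_sym x x'; have e2 := metric_sym y y'.
rewrite ler_norml; lra.
Qed.

Lemma continuous_mdist2 : continuous (fun z : X * X => mdist z.1 z.2).
Proof.
move=> [x y]; apply/cvgrPdist_lt => e e0 /=.
have e20 : 0 < e / 2 by rewrite divr_gt0.
exists (ball x (e / 2), ball y (e / 2)).
  by split => /=; exact: nbhsx_ballx.
move=> [x' y'] /= []; rewrite !ballEmdist /= => h1 h2.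
by rewrite (le_lt_trans (mdist_ler_norm _ _ _ _))//; lra.
Qed.

Lemma continuous_mdist x : continuous (mdist x).
Proof.
move=> y; apply/cvgrPdist_lt => e e0 /=.
apply: filterS (nbhsx_ballx y e e0) => y'; rewrite ballEmdist /= => yy'.
by rewrite (le_lt_trans (mdist_ler_norm _ _ _ _))// mdistxx add0r.
Qed.

Lemma open_mball x r : open (ball x r).
Proof.
rewrite ballEmdist (_ : [set _ | _] = mdist x @^-1` [set u | u < r])//.
by apply: open_comp => [y _|]; [exact: continuous_mdist|exact: open_lt].
Qed.

Lemma borel_open (U : set X) : open U -> measurable (U : set (borel X)).
Proof. exact: sub_sigma_algebra. Qed.

Lemma measurable_mball x r : measurable (ball x r : set (borel X)).
Proof. by apply: borel_open; exact: open_mball. Qed.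

Lemma continuous_borel_measurable (f : X -> R) : continuous f ->
  measurable_fun setT (f : borel X -> R).
Proof.
move=> cf; apply: (measurability _ (RGenOInfty.measurableE R)).
move=> _ [_ [a ->] <-]; rewrite setTI; apply: borel_open.
by apply: open_comp => [y _|]; [exact: cf|exact: interval_open].
Qed.

Lemma measurable_mdist x : measurable_fun setT (mdist x : borel X -> R).
Proof. by apply: continuous_borel_measurable; exact: continuous_mdist. Qed.

End metric_borel.

(** * Integrals of decaying functions under Ahlfors regularity *)

Section ahlfors.
Context {R : realType} {X : pmetricType R}.
Variables (mu : {measure set (borel X) -> \bar R}) (dH : R).
Hypotheses (dH_gt0 : 0 < dH) (A2 : ahlfors_regular mu dH).
Implicit Types (x y z : X) (r : R).

Lemma mu_ball_lty x r : (mu (ball x r) < +oo)%E.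
Proof.
have [c1 [c2 [_ _ h]]] := A2.
apply: (@le_lt_trans _ _ (mu (ball x (Num.max 0 r)))).
  apply: le_measure; rewrite ?inE; try exact: measurable_mball.
  by apply: le_ball; rewrite le_max lexx orbT.
have /andP[_ h2] := h x (Num.max 0 r) ltac:(by rewrite le_max lexx).
exact: le_lt_trans h2 (ltry _).
Qed.

Lemma ahlfors_sigma_finite : sigma_finite setT mu.
Proof.
exists (fun n => ball (point : X) n%:R) => [|n].
  apply/seteqP; split => // y _; exists (Num.bound (mdist point y)) => //.
  by rewrite ballEmdist /=; apply: archi_boundP; exact: mdist_ge0.
by split; [exact: measurable_mball|exact: mu_ball_lty].
Qed.

Let geom_sum_le2 n : \sum_(k < n) (2 ^- k : R) <= 2.
Proof.
suff -> : \sum_(k < n) (2 ^- k : R) = 2 - 2 * 2 ^- n.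
  by rewrite lerBlDr lerDl mulr_ge0// invr_ge0 exprn_ge0.
elim: n => [|n IH]; first by rewrite big_ord0 expr0 invr1 mulr1 subrr.
by rewrite big_ord_recr /= IH exprS; field.
Qed.

(** Summing over dyadic balls of radius [r * 2 ^+ k], the volume growth
    [2 ^ (k * dH)] meets the decay [2 ^ (- k * (dH + 1))]; the exponent [dH + 1]
    is chosen to leave the geometric series of ratio [1/2]. *)
Lemma ahlfors_tail_integral : exists2 C : R, 0 < C &
  forall x r, 0 < r ->
    (\int[mu]_y ((1 + mdist x y / r) `^ (- (dH + 1)))%:E <= (C * r `^ dH)%:E)%E.
Proof.
have [c1 [c2 [_ c20 h]]] := A2.
set M := dH + 1; have M0 : 0 < M by rewrite addr_gt0.
exists (2 `^ M * c2 * 2) => [|x r r0]; first by rewrite !mulr_gt0// powR_gt0.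
have p2 (k : nat) : 0 < 2 ^+ k :> R by rewrite exprn_gt0.
pose g k (y : borel X) : \bar R :=
  (2 `^ M * (2 ^+ k) `^ (- M) * \1_(ball x (r * 2 ^+ k)) y)%:E.
have g0 k y : (0 <= g k y)%E.
  by rewrite /g lee_fin !mulr_ge0 ?powR_ge0.
have mg k : measurable_fun setT (g k).
  apply/measurable_EFinP; apply: measurable_funM => //.
  by apply: measurable_indic; exact: measurable_mball.
have mlhs : measurable_fun [set: borel X]
    (fun y => ((1 + mdist x y / r) `^ (- M))%:E).
  apply/measurable_EFinP; apply: (measurableT_comp (measurable_powR _)).
  by apply: measurable_funD => //; apply: measurable_funM => //; exact: measurable_mdist.
apply: (@le_trans _ _ (\int[mu]_y (\sum_(0 <= k <oo) g k y))%E).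
  apply: ge0_le_integral => //.
  - by move=> y _; rewrite lee_fin powR_ge0.
  - exact: (@ge0_emeasurable_sum _ _ _ setT g xpredT
      (fun k y _ _ => g0 k y) (fun k _ => mg k)).
  - move=> y _; have [|k vk hk] := @dyadic_domination _ M (mdist x y / r) (ltW M0).
      by rewrite divr_ge0 ?mdist_ge0// ltW.
    apply: (le_trans _ (nneseries_lim_ge k.+1 _)); last by move=> *; exact: g0.
    rewrite big_nat_recr//= -[leLHS]add0e leeD ?sume_ge0//.
    rewrite /g lee_fin indicE mem_set ?mulr1//.
    by rewrite ballEmdist /= mulrC -ltr_pdivrMr.
rewrite integral_nneseries//; apply: lime_le.
  by apply: is_cvg_nneseries => *; exact: integral_ge0.
apply: nearW => n.
have intg k : (\int[mu]_y g k y <= (2 `^ M * c2 * r `^ dH * 2 ^- k)%:E)%E.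
  rewrite /g; under eq_integral do rewrite EFinM.
  rewrite ge0_integralZl//; last first.
    by apply/measurable_EFinP; apply: measurable_indic; exact: measurable_mball.
  rewrite integral_indic ?setIT//; last exact: measurable_mball.
  have /andP[_ H] := h x (r * 2 ^+ k) ltac:(by rewrite mulr_ge0// ltW).
  apply: (@le_trans _ _ ((2 `^ M * (2 ^+ k) `^ (- M))%:E *
                         (c2 * (r * 2 ^+ k) `^ dH)%:E)%E).
    by apply: lee_wpmul2l => //; rewrite lee_fin mulr_ge0 ?powR_ge0.
  rewrite -EFinM lee_fin powRM ?(ltW r0) ?(ltW (p2 _))//.
  have -> : 2 ^- k = (2 ^+ k) `^ (- M) * (2 ^+ k) `^ dH :> R.
    rewrite -powRD; last by apply/implyP => _; rewrite gt_eqF.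
    by rewrite /M opprD addrAC addNr sub0r powR_inv1 ?(ltW (p2 _)).
  by rewrite le_eqVlt; apply/orP; left; apply/eqP; ring.
apply: (@le_trans _ _ (\sum_(0 <= k < n) (2 `^ M * c2 * r `^ dH * 2 ^- k)%:E)%E).
  by apply: lee_sum => k _; exact: intg.
rewrite sumEFin lee_fin -mulr_sumr big_mkord.
rewrite [leRHS](_ : _ = 2 `^ M * c2 * r `^ dH * 2); last by ring.
by rewrite ler_wpM2l ?geom_sum_le2// !mulr_ge0 ?powR_ge0// ltW.
Qed.

End ahlfors.

(** * From almost everywhere to everywhere *)

Definition sigma_finite_pack d (T : measurableType d) (R : realType)
    (mu : {measure set T -> \bar R}) (mu_sf : sigma_finite setT mu) :
    {sigma_finite_measure set T -> \bar R} :=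
  HB.pack_for (SigmaFiniteMeasure.type T R) (Measure.sort mu)
    (isSFinite.Build _ _ _ _ (sfinite_measure_sigma_finite mu_sf))
    (isSigmaFinite.Build _ _ _ _ mu_sf).

Section full_support_comparison.
Context {R : realType} {X : pmetricType R}.
Variable mu : {measure set (borel X) -> \bar R}.
Hypotheses (mu_sf : sigma_finite setT mu) (mu_support : full_support mu).

(** The set where two continuous functions differ is open, and a nonempty open
    set is not negligible. *)
Lemma ae_continuous_eq (f g : X -> R) : continuous f -> continuous g ->
  {ae mu, forall x, f x = g x} -> f = g.
Proof.
move=> cf cg [N [mN N0 fgN]]; apply/funext => x; apply/eqP.
apply: contraT => /eqP fgx; exfalso.
pose U := [set y | f y - g y != 0].
have oU : open U.
  rewrite (_ : U = (f \- g) @^-1` [set u | u != 0])//.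
  by apply: open_comp => [y _|]; [exact: cvgB (cf y) (cg y)|exact: open_neq].
have Ux : U x by rewrite /U /= subr_eq0; exact/eqP.
have : (0 < mu U)%E by apply: mu_support => //; exists x.
rewrite lt_neqAle => /andP[/negP H _]; apply: H; rewrite eq_sym -measure_le0 -N0.
apply: le_measure; rewrite ?inE//; first exact: borel_open.
by move=> y Uy; apply: fgN => /= fgy; move: Uy; rewrite /U /= fgy subrr eqxx.
Qed.

(** Same argument as for [ae_continuous_eq], with a product of two balls as the
    non-negligible open set. *)
Lemma ae_prod_continuous_le (f g : X * X -> R) : continuous f -> continuous g ->
  {ae (mu \x mu)%E, forall z : borel X * borel X, f z <= g z} ->
  forall z, f z <= g z.
Proof.
move=> cf cg [N [mN N0 fgN]] [x y]; rewrite leNgt; apply/negP => fgx.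
pose mu' := sigma_finite_pack mu_sf.
pose U := [set z | 0 < f z - g z].
have oU : open U.
  rewrite (_ : U = (f \- g) @^-1` [set u | 0 < u])//.
  by apply: open_comp => [z _|]; [exact: cvgB (cf z) (cg z)|exact: open_gt].
have : nbhs (x, y) U by apply: open_nbhs_nbhs; split => //; rewrite /U /= subr_gt0.
case=> -[A B] /= [/nbhs_ballP[a /= a0 aA] /nbhs_ballP[b /= b0 bB]] ABU.
have ball_gt0 z e : 0 < e -> (0 < mu (ball z e))%E.
  by move=> e0; apply: mu_support; [exact: open_mball|exists z; exact: ballxx].
have : (0 < (mu' \x mu') (ball x a `*` ball y b))%E.
  rewrite product_measure1E; try exact: measurable_mball.
  by rewrite mule_gt0//; exact: ball_gt0.
rewrite lt_neqAle => /andP[/negP H _]; apply: H; rewrite eq_sym -measure_le0 -N0.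
apply: (@le_measure _ _ _ (mu' \x mu')%E); rewrite ?inE//.
  by apply: measurableX; exact: measurable_mball.
move=> [x' y'] [/= /aA Ax /bB By]; apply: fgN => /=; apply/negP; rewrite -ltNge.
by rewrite -subr_gt0; exact: (ABU (x', y')).
Qed.

End full_support_comparison.

(** * Pointwise bounds on the heat kernel *)

Lemma continuous_comp_continuous {S T U : topologicalType} (f : S -> T)
  (g : T -> U) : continuous f -> continuous g -> continuous (g \o f).
Proof. by move=> cf cg z; exact: (continuous_comp (cf z) (cg (f z))). Qed.

Lemma continuous_powR_norm {R : realType} (q : R) : 0 < q ->
  continuous (fun u : R => `|u| `^ q).
Proof.
move=> q0 u; have [->|u0] := eqVneq u 0.
  rewrite /continuous_at normr0 powR0 ?gt_eqF//; apply/cvgr0Pnorm_lt => e e0.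
  have d0 : 0 < e `^ q^-1 by rewrite powR_gt0.
  apply: filterS (nbhsx_ballx (0 : R) _ d0) => v.
  rewrite /ball /= sub0r normrN => hv; rewrite ger0_norm ?powR_ge0//.
  rewrite -[ltRHS](powRr1 (ltW e0)) -(mulVf (lt0r_neq0 q0)) powRrM.
  by apply: gt0_ltr_powR => //; rewrite ?nnegrE ?powR_ge0.
suff : {for u, continuous ((fun w : R => w `^ q) \o (fun v : R => `|v|))} by [].
apply: continuous_comp; first exact: norm_continuous.
apply/differentiable_continuous/derivable1_diffP/derivable_powR.
by rewrite in_itv /= andbT normr_gt0.
Qed.

Lemma cvg_powR_norm0 {R : realType} {T : Type} (F : set_system T) {FF : Filter F}
  (q : R) (u : T -> R) : 0 < q -> u @ F --> 0 -> `|u x| `^ q @[x --> F] --> 0.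
Proof.
move=> q0 u0; have c := @continuous_powR_norm R q q0 0.
rewrite /continuous_at normr0 powR0 ?gt_eqF// in c.
exact: (cvg_comp _ _ u0 c).
Qed.

Section heat_kernel_bounds.
Context {R : realType} {X : pmetricType R}.
Variables (mu : {measure set (borel X) -> \bar R}) (p : R -> X -> X -> R).
Variables (dH dW : R).
Hypotheses (dH_gt0 : 0 < dH) (dW_ge2 : 2 <= dW).
Implicit Types (x y : X) (t c : R).

Let dW0 : 0 < dW. Proof. exact: lt_le_trans dW_ge2. Qed.
Let dW1 : 0 < dW - 1. Proof. by have := dW_ge2; lra. Qed.

Lemma sub_gaussian_ge0 c c' t x y : 0 <= c -> 0 <= sub_gaussian dH dW c c' t x y.
Proof. by move=> c0; rewrite !mulr_ge0 ?powR_ge0 ?expR_ge0. Qed.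

Lemma continuous_sub_gaussian c c' t : 0 < t ->
  continuous (fun z : X * X => sub_gaussian dH dW c c' t z.1 z.2).
Proof.
move=> t0.
pose g1 (u : R) := `|u| `^ dW / t.
pose g2 (u : R) := `|u| `^ (1 / (dW - 1)).
have cg1 : continuous g1 by move=> u; apply: cvgMr_tmp; exact: continuous_powR_norm.
have cg2 : continuous g2 by apply: continuous_powR_norm; rewrite divr_gt0.
pose g3 (u : R) := - c' * u.
have cg3 : continuous g3 by move=> u; apply: cvgMl_tmp; exact: cvg_id.
pose g4 (u : R) := c * t `^ (- dH / dW) * expR u.
have cg4 : continuous g4 by move=> u; apply: cvgMl_tmp; exact: continuous_expR.
have -> : (fun z : X * X => sub_gaussian dH dW c c' t z.1 z.2) =
    g4 \o (g3 \o (g2 \o (g1 \o (fun z : X * X => mdist z.1 z.2)))).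
  apply/funext => z; rewrite /sub_gaussian /g4 /g3 /g2 /g1 /=.
  by rewrite (ger0_norm (mdist_ge0 _ _)) ger0_norm// divr_ge0 ?powR_ge0// ltW.
by do 4 (apply: continuous_comp_continuous; last by []); exact: continuous_mdist2.
Qed.

(** In terms of the rescaled distance [v = mdist x y / t `^ dW^-1] the exponential
    factor is [expR (- c' * v `^ (dW / (dW - 1)))], which beats every power. *)
Lemma sub_gaussian_decay c c' q : 0 < c -> 0 < c' -> 0 <= q ->
  exists2 K, 0 < K & forall t x y, 0 < t ->
    sub_gaussian dH dW c c' t x y * (1 + mdist x y / t `^ dW^-1) `^ q
      <= K * t `^ (- dH / dW).
Proof.
move=> c0 c'0 q0.
have g0 : 0 < dW * (1 / (dW - 1)) by rewrite mulr_gt0 ?divr_gt0.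
have [K K0 h] := @powR_mul_expRN_bounded R q c' _ q0 c'0 g0.
exists (c * K) => [|t x y t0]; first by rewrite mulr_gt0.
have v0 : 0 <= mdist x y / t `^ dW^-1 by rewrite divr_ge0 ?mdist_ge0 ?powR_ge0.
rewrite /sub_gaussian.
have -> : (mdist x y `^ dW / t) = (mdist x y / t `^ dW^-1) `^ dW.
  rewrite powRM ?mdist_ge0 ?invr_ge0 ?powR_ge0//; congr (_ * _).
  rewrite -powRN -powRrM mulNr mulVf ?gt_eqF// powR_inv1//; exact: ltW.
rewrite -powRrM; have := h _ v0; set e := expR _; set w := _ `^ q => we.
have -> : c * t `^ (- dH / dW) * e * w = c * t `^ (- dH / dW) * (w * e) by ring.
by rewrite [leRHS]mulrAC ler_wpM2l ?mulr_ge0 ?powR_ge0 ?(ltW c0).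
Qed.

Lemma sub_gaussian_le_diag c c' t x y : 0 <= c -> 0 <= c' ->
  0 < t -> sub_gaussian dH dW c c' t x y <= c * t `^ (- dH / dW).
Proof.
move=> c0 c'0 t0; rewrite /sub_gaussian ler_piMr ?mulr_ge0 ?powR_ge0//.
by rewrite expR_le1 mulNr oppr_le0 mulr_ge0 ?powR_ge0.
Qed.

(** With [u = mdist x y `^ dW / s], the time factor [s `^ (- dH / dW)] is
    [mdist x y `^ (- dH) * u `^ (dH / dW)]; the exponential makes
    [u `^ (dH / dW)] at most a multiple of [(1 + u)^-1], which is bounded by
    [1 - expR (- u^-1)].  The right-hand side depends on time through [1 - expR (- (s * l))] only, and so
    can be integrated against a density known by its Laplace transform. *)
Lemma sub_gaussian_le_laplace c c' : 0 < c -> 0 < c' -> exists2 A, 0 < A &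
  forall (s : R) x y, 0 < s -> x != y -> sub_gaussian dH dW c c' s x y <=
    A * mdist x y `^ (- dH) * (1 - expR (- (s * mdist x y `^ (- dW)))).
Proof.
move=> c0 c'0.
have a0 : 0 < dH / dW by rewrite divr_gt0.
have b0 : 0 < 1 / (dW - 1) by rewrite divr_gt0.
have [K K0 h] := @powR_mul_expRN_bounded R (dH / dW + 1) c' _
  (addr_ge0 (ltW a0) ler01) c'0 b0.
exists (c * K) => [|s x y s0 xy]; first by rewrite mulr_gt0.
have d0 : 0 < mdist x y by rewrite mdist_gt0.
rewrite /sub_gaussian; set u := mdist x y `^ dW / s.
have u0 : 0 < u by rewrite divr_gt0 ?powR_gt0.
have -> : s `^ (- dH / dW) = mdist x y `^ (- dH) * u `^ (dH / dW).
  rewrite /u powRM ?powR_ge0 ?invr_ge0 ?(ltW s0)// -powRrM.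
  rewrite (mulrC dW) divfK ?lt0r_neq0// mulrA -powRD; last first.
    by rewrite (lt0r_neq0 d0) implybT.
  by rewrite addNr powRr0 mul1r -(powR_inv1 (ltW s0)) -powRrM mulN1r mulNr.
have -> : s * mdist x y `^ (- dW) = u^-1 by rewrite /u invf_div powRN.
rewrite mulrA -mulrA (mulrAC c K) -[leRHS]mulrA.
apply: ler_wpM2l; first by rewrite mulr_ge0 ?powR_ge0// ltW.
apply: (@le_trans _ _ (K * (1 + u)^-1)); last first.
  by apply: ler_wpM2l; [exact: ltW|exact: inv1D_le_1BexpRN].
have u10 : 0 < 1 + u by rewrite addr_gt0.
rewrite ler_pdivlMr// mulrAC; apply: le_trans (h u (ltW u0)).
rewrite ler_wpM2r ?expR_ge0// powRD ?(lt0r_neq0 u10) ?implybT//.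
rewrite powRr1 ?(ltW u10)// ler_wpM2r ?(ltW u10)//.
by apply: ge0_ler_powR; rewrite ?nnegrE ?(ltW a0) ?(ltW u0) ?(ltW u10)// lerDr.
Qed.

Hypotheses (A2 : ahlfors_regular mu dH) (mu_support : full_support mu).
Hypothesis pcont : forall t, 0 < t -> continuous (fun z : X * X => p t z.1 z.2).
Hypothesis HK : heat_kernel_estimates mu p dH dW.

(** For each time both estimates compare continuous functions of the two points,
    and the support of [mu] is the whole space. *)
Lemma heat_kernel_estimates_everywhere :
  exists c3 c4 c5 c6 : R, [/\ 0 < c3, 0 < c4, 0 < c5, 0 < c6 &
    forall t x y, 0 < t ->
      sub_gaussian dH dW c5 c6 t x y <= p t x y
        <= sub_gaussian dH dW c3 c4 t x y].
Proof.
have [c3 [c4 [c5 [c6 [c30 c40 c50 c60 h]]]]] := HK.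
exists c3, c4, c5, c6; split=> // t x y t0.
have mu_sf := ahlfors_sigma_finite A2.
apply/andP; split.
- apply: (@ae_prod_continuous_le _ _ mu mu_sf mu_support
    (fun z : X * X => sub_gaussian dH dW c5 c6 t z.1 z.2)
    (fun z : X * X => p t z.1 z.2) _ _ _ (x, y)).
  + exact: continuous_sub_gaussian.
  + exact: pcont.
  + have [N [mN N0 hN]] := h t t0; exists N; split => // z /= hz; apply: hN => /=.
    by move=> /andP[].
- apply: (@ae_prod_continuous_le _ _ mu mu_sf mu_support
    (fun z : X * X => p t z.1 z.2)
    (fun z : X * X => sub_gaussian dH dW c3 c4 t z.1 z.2) _ _ _ (x, y)).
  + exact: pcont.
  + exact: continuous_sub_gaussian.
  + have [N [mN N0 hN]] := h t t0; exists N; split => // z /= hz; apply: hN => /=.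
    by move=> /andP[].
Qed.

Lemma measurable_heat_kernel t x : 0 < t ->
  measurable_fun setT (p t x : borel X -> R).
Proof.
move=> t0; apply: continuous_borel_measurable => y.
apply: (@continuous_comp_continuous X (X * X)%type R (fun y => (x, y))
  (fun z => p t z.1 z.2)); last exact: pcont.
by move=> z; apply: cvg_pair; [exact: cvg_cst|exact: cvg_id].
Qed.

(** The upper estimate decays faster than any power of the rescaled distance, so
    the weight can be absorbed while keeping a decay that beats the volume growth
    of balls; the scales [t `^ (- dH / dW)] and [(t `^ dW^-1) `^ dH] cancel. *)
Lemma heat_kernel_moment q : 0 <= q -> exists2 K : R, 0 < K &
  forall t x, 0 < t ->
    (\int[mu]_y (p t x y * (1 + mdist x y / t `^ dW^-1) `^ q)%:E <= K%:E)%E.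
Proof.
move=> q0.
have [c3 [c4 [c5 [c6 [c30 c40 c50 c60 h]]]]] := heat_kernel_estimates_everywhere.
have qM0 : 0 <= q + (dH + 1) by rewrite !addr_ge0// ltW.
have [K K0 hK] := sub_gaussian_decay c30 c40 qM0.
have [C C0 hC] := ahlfors_tail_integral dH_gt0 A2.
exists (K * C) => [|t x t0]; first by rewrite mulr_gt0.
have r0 : 0 < t `^ dW^-1 by rewrite powR_gt0.
have v0 y : 0 <= mdist x y / t `^ dW^-1 by rewrite divr_ge0 ?mdist_ge0// ltW.
have mv a : measurable_fun setT
    (fun y : borel X => (1 + mdist x y / t `^ dW^-1) `^ a).
  apply: (measurableT_comp (measurable_powR _)).
  by apply: measurable_funD => //; apply: measurable_funM => //; exact: measurable_mdist.
apply: (@le_trans _ _ (\int[mu]_y ((K * t `^ (- dH / dW))%:E *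
    ((1 + mdist x y / t `^ dW^-1) `^ (- (dH + 1)))%:E))%E).
  apply: ge0_le_integral => //.
  - move=> y _; rewrite lee_fin mulr_ge0 ?powR_ge0//.
    have /andP[+ _] := h t x y t0; apply: le_trans.
    exact/sub_gaussian_ge0/ltW.
  - apply/measurable_EFinP; apply: measurable_funM; last exact: mv.
    exact: measurable_heat_kernel.
  - by apply: measurable_funeM; apply/measurable_EFinP; exact: mv.
  - move=> y _; rewrite -EFinM lee_fin.
    have /andP[_ pu] := h t x y t0.
    have H : 0 < 1 + mdist x y / t `^ dW^-1 by rewrite ltr_wpDr.
    rewrite powRN -ler_pdivrMr ?invr_gt0 ?powR_gt0// invrK -mulrA.
    rewrite -powRD ?(lt0r_neq0 H) ?implybT//.
    apply: le_trans (hK t x y t0).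
    by rewrite ler_wpM2r ?powR_ge0.
rewrite ge0_integralZl//; last 3 first.
- by apply/measurable_EFinP; exact: mv.
- by move=> y _; rewrite lee_fin powR_ge0.
- by rewrite lee_fin mulr_ge0 ?powR_ge0// ltW.
apply: (@le_trans _ _ ((K * t `^ (- dH / dW))%:E * (C * (t `^ dW^-1) `^ dH)%:E)%E).
  apply: lee_wpmul2l; first by rewrite lee_fin mulr_ge0 ?powR_ge0// ltW.
  exact: hC.
rewrite -EFinM lee_fin -powRrM mulrACA -powRD; last by rewrite (lt0r_neq0 t0) implybT.
by rewrite mulNr (mulrC dH) addNr powRr0 mulr1.
Qed.

(** On the ball of radius [t `^ dW^-1] the lower estimate is of order
    [t `^ (- dH / dW)], the inverse of the volume of that ball. *)
Lemma heat_kernel_mass_lower_bound : exists2 m : R, 0 < m &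
  forall t x, 0 < t -> (m%:E <= \int[mu]_y (p t x y)%:E)%E.
Proof.
have [c3 [c4 [c5 [c6 [c30 c40 c50 c60 h]]]]] := heat_kernel_estimates_everywhere.
have [c1 [c2 [c10 c20 hA]]] := A2.
exists (c5 * expR (- c6) * c1) => [|t x t0]; first by rewrite !mulr_gt0 ?expR_gt0.
have r0 : 0 < t `^ dW^-1 by rewrite powR_gt0.
pose B := ball x (t `^ dW^-1) : set (borel X).
have mB : measurable B by exact: measurable_mball.
have k0 : 0 <= c5 * t `^ (- dH / dW) * expR (- c6).
  by rewrite !mulr_ge0 ?powR_ge0 ?expR_ge0// ltW.
apply: (@le_trans _ _ (\int[mu]_y
    ((c5 * t `^ (- dH / dW) * expR (- c6))%:E * (\1_B y)%:E))%E); last first.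
  apply: ge0_le_integral => //.
  - by move=> y _; rewrite -EFinM lee_fin mulr_ge0.
  - by apply: measurable_funeM; apply/measurable_EFinP; exact: measurable_indic.
  - by apply/measurable_EFinP; exact: measurable_heat_kernel.
  - move=> y _; rewrite -EFinM lee_fin.
    have /andP[pl _] := h t x y t0; apply: le_trans pl.
    rewrite indicE; case: (boolP (y \in B)) => [|_]; last first.
      by rewrite mulr0 sub_gaussian_ge0// ltW.
    rewrite inE /B ballEmdist /= => xy.
    rewrite mulr1 /sub_gaussian ler_wpM2l//.
      by rewrite mulr_ge0 ?powR_ge0// ltW.
    rewrite ler_expR mulNr lerN2 ger_pMr//.
    have d1 : mdist x y `^ dW / t <= 1.
      rewrite ler_pdivrMr// mul1r.
      rewrite -[leRHS](powRr1 (ltW t0)) -(mulVf (lt0r_neq0 dW0)) powRrM.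
      by apply: ge0_ler_powR; rewrite ?nnegrE ?mdist_ge0 ?powR_ge0 ?(ltW dW0) ?(ltW xy).
    apply: (@le_trans _ _ (1 `^ (1 / (dW - 1)))); last by rewrite powR1.
    apply: ge0_ler_powR => //; rewrite ?nnegrE ?divr_ge0 ?powR_ge0//; exact: ltW.
rewrite ge0_integralZl//; last by apply/measurable_EFinP; exact: measurable_indic.
rewrite integral_indic// setIT.
have /andP[hl _] := hA x (t `^ dW^-1) (ltW r0).
apply: (@le_trans _ _ ((c5 * t `^ (- dH / dW) * expR (- c6))%:E *
    (c1 * (t `^ dW^-1) `^ dH)%:E)%E); last exact: lee_wpmul2l.
rewrite -EFinM lee_fin -powRrM.
have -> : t `^ (- dH / dW) = (t `^ (dW^-1 * dH))^-1 by rewrite -powRN mulNr mulrC.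
rewrite le_eqVlt; apply/orP; left; apply/eqP; field.
by rewrite lt0r_neq0// powR_gt0.
Qed.

End heat_kernel_bounds.

(** * Integrable real-valued functions *)

Section integral_tools.
Context d (T : measurableType d) (R : realType).
Variable mu : {measure set T -> \bar R}.

Lemma integrable_dominated (f g : T -> R) : measurable_fun setT f ->
  mu.-integrable setT (EFin \o g) -> (forall x, `|f x| <= g x) ->
  mu.-integrable setT (EFin \o f).
Proof.
move=> mf ig fg; apply: le_integrable ig => //; first exact/measurable_EFinP.
by move=> x _ /=; rewrite lee_fin (le_trans (fg x))// ler_norm.
Qed.

Lemma ge0_integrable_le (f : T -> R) (K : R) : measurable_fun setT f ->
  (forall x, 0 <= f x) -> (\int[mu]_x (f x)%:E <= K%:E)%E ->
  mu.-integrable setT (EFin \o f).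
Proof.
move=> mf f0 fK; apply/integrableP; split; first exact/measurable_EFinP.
under eq_integral do rewrite /= ger0_norm//.
exact: le_lt_trans fK (ltry _).
Qed.

Lemma Rintegral_le_bound (f : T -> R) (K : R) : (forall x, 0 <= f x) ->
  (\int[mu]_x (f x)%:E <= K%:E)%E -> \int[mu]_x f x <= K.
Proof.
move=> f0 fK; rewrite -lee_fin fineK//.
rewrite ge0_fin_numE; first exact: le_lt_trans fK (ltry _).
by apply: integral_ge0 => x _; rewrite lee_fin.
Qed.

Lemma cvg_Rintegral (f_ : nat -> T -> R) (f g : T -> R) :
  (forall n, measurable_fun setT (f_ n)) -> (forall x, f_ ^~ x @ \oo --> f x) ->
  mu.-integrable setT (EFin \o g) -> (forall n x, `|f_ n x| <= g x) ->
  \int[mu]_x f_ n x @[n --> \oo] --> \int[mu]_x f x.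
Proof.
move=> mf_ f_f ig fg.
have mf : measurable_fun setT f by apply: (measurable_fun_cvg mf_) => x _.
have if_ : mu.-integrable setT (EFin \o f).
  apply: integrable_dominated ig _ => // x.
  have h : `|f_ n x| @[n --> \oo] --> `|f x| by exact: cvg_norm.
  rewrite -(cvg_lim _ h)//; apply: limr_le; first by apply/cvg_ex; eexists; exact: h.
  by apply: nearW.
apply: fine_cvg; rewrite fineK; last exact: integrable_fin_num.
apply: (@dominated_cvg _ _ _ mu setT measurableT
  (fun n x => (f_ n x)%:E) _ (EFin \o g)) => //.
- by move=> n; exact/measurable_EFinP.
- by move=> x _; apply: cvg_EFin; [exact: nearW|exact: f_f].
- by move=> n x _; rewrite /= lee_fin.
Qed.

Lemma Lnorm_infty_le (g : T -> R) (M : R) : 0 <= M -> (forall x, `|g x| <= M) ->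
  ('N[mu]_+oo[EFin \o g] <= M%:E)%E.
Proof.
move=> M0 gM; rewrite unlock /Lnorm; case: ifPn => _; last by rewrite lee_fin.
by apply/ess_supP; apply: nearW => x /=; rewrite lee_fin.
Qed.

End integral_tools.

(** * The heat operator on bounded functions *)

Definition bounded_measurable {R : realType} {X : pmetricType R} (g : X -> R)
  (M : R) := measurable_fun setT (g : borel X -> R) /\ forall x, `|g x| <= M.

Section heat_operator.
Context {R : realType} {X : pmetricType R}.
Variables (mu : {measure set (borel X) -> \bar R}) (p : R -> X -> X -> R).
Variables (dW kappa K m C : R).
Hypotheses (dW_gt0 : 0 < dW) (kappa_gt0 : 0 < kappa) (m_gt0 : 0 < m).
Hypothesis C_gt0 : 0 < C.
Hypothesis p_ge0 : forall (t : R) x y, 0 < t -> 0 <= p t x y.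
Hypothesis p_meas : forall (t : R) x, 0 < t ->
  measurable_fun setT (p t x : borel X -> R).
Hypothesis p_moment : forall (t : R) x, 0 < t ->
  (\int[mu]_y (p t x y * (1 + mdist x y / t `^ dW^-1) `^ kappa)%:E <= K%:E)%E.
Hypothesis p_mass : forall (t : R) x, 0 < t -> (m%:E <= \int[mu]_y (p t x y)%:E)%E.
Hypothesis BE : forall (t : R) (g : X -> R) (x y : X), 0 < t ->
  (g : borel X -> R) \in Lfun mu +oo%E ->
  (`|heat_op mu p t g x - heat_op mu p t g y|%:E <=
    (C * (mdist x y `^ kappa / t `^ (kappa / dW)))%:E * 'N[mu]_+oo[EFin \o g])%E.

Implicit Types (x y : X) (t s M : R) (g : X -> R).

Let weight t x y := (1 + mdist x y / t `^ dW^-1) `^ kappa.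

Let v_ge0 t x y : 0 <= mdist x y / t `^ dW^-1.
Proof. by rewrite divr_ge0 ?mdist_ge0 ?powR_ge0. Qed.

Let weight_ge1 t x y : 1 <= weight t x y.
Proof.
rewrite /weight -[leLHS](powRr0 (1 + mdist x y / t `^ dW^-1)).
by rewrite ler_powR// ?lerDl// ltW.
Qed.

(* The weight turns kappa-th powers of the distance into powers of time. *)
Let mdist_le_weight t x y : 0 < t ->
  mdist x y `^ kappa <= t `^ (kappa / dW) * weight t x y.
Proof.
move=> t0; have r0 : 0 < t `^ dW^-1 by rewrite powR_gt0.
rewrite (mulrC kappa) powRrM -powRM ?addr_ge0 ?(ltW r0)//.
apply: ge0_ler_powR; rewrite ?nnegrE ?mdist_ge0 ?(ltW kappa_gt0)//.
  by rewrite mulr_ge0 ?(ltW r0)// addr_ge0.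
by rewrite mulrDr mulr1 mulrC divfK ?lt0r_neq0// lerDr ltW.
Qed.

Let weighted_measurable t x : 0 < t ->
  measurable_fun setT (fun y : borel X => p t x y * weight t x y).
Proof.
move=> t0; apply: measurable_funM; first exact: p_meas.
apply: (measurableT_comp (measurable_powR _)).
by apply: measurable_funD => //; apply: measurable_funM => //; exact: measurable_mdist.
Qed.

Let weighted_ge0 t x y : 0 < t -> 0 <= p t x y * weight t x y.
Proof. by move=> t0; rewrite mulr_ge0 ?p_ge0 ?powR_ge0. Qed.

Let weighted_integrable t x : 0 < t ->
  mu.-integrable setT (fun y => (p t x y * weight t x y)%:E).
Proof.
move=> t0; apply: (ge0_integrable_le (weighted_measurable x t0)) => [y|].
  exact: weighted_ge0.
exact: p_moment.
Qed.

Let weighted_le t x : 0 < t -> \int[mu]_y (p t x y * weight t x y) <= K.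
Proof.
move=> t0; apply: Rintegral_le_bound => [y|]; first exact: weighted_ge0.
exact: p_moment.
Qed.

Let p_le_weighted t x y : 0 < t -> p t x y <= p t x y * weight t x y.
Proof. by move=> t0; rewrite ler_peMr ?p_ge0. Qed.

Lemma heat_kernel_integrable t x : 0 < t ->
  mu.-integrable setT (fun y => (p t x y)%:E).
Proof.
move=> t0; apply: (integrable_dominated (p_meas x t0) (weighted_integrable x t0)).
by move=> y; rewrite ger0_norm ?p_ge0 ?p_le_weighted.
Qed.

Lemma heat_op_integrable t x g M : 0 < t -> bounded_measurable g M ->
  mu.-integrable setT (fun y => (p t x y * g y)%:E).
Proof.
move=> t0 [mg gM].
have M0 : 0 <= M by apply: le_trans (gM point).
apply: (@integrable_dominated _ _ _ mu _ (fun y => M * p t x y)).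
- by apply: measurable_funM => //; exact: p_meas.
- by have /(integrableZl measurableT M) := heat_kernel_integrable x t0.
- by move=> y; rewrite normrM ger0_norm ?p_ge0// mulrC ler_wpM2r ?p_ge0.
Qed.

Let K_ge0 : 0 <= K.
Proof.
have t0 : 0 < (1 : R) by [].
apply: le_trans (weighted_le point t0).
by apply: Rintegral_ge0 => y _; exact: weighted_ge0.
Qed.

Lemma heat_op_bounded t x g M : 0 < t -> bounded_measurable g M ->
  `|heat_op mu p t g x| <= K * M.
Proof.
move=> t0 bg; have [mg gM] := bg.
have M0 : 0 <= M by apply: le_trans (gM point).
apply: le_trans (le_normr_Rintegral measurableT (heat_op_integrable x t0 bg)) _.
apply: (@le_trans _ _ (\int[mu]_y (M * (p t x y * weight t x y)))).
  apply: le_Rintegral => //.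
  - have /integrable_norm := heat_op_integrable x t0 bg; exact.
  - by have /(integrableZl measurableT M) := weighted_integrable x t0.
  - move=> y _; rewrite normrM ger0_norm ?p_ge0// mulrC ler_pM ?p_ge0//.
    exact: p_le_weighted.
rewrite RintegralZl//; last exact: weighted_integrable.
by rewrite mulrC ler_wpM2r// weighted_le.
Qed.

Lemma bounded_Lfun_infty g M : bounded_measurable g M ->
  (g : borel X -> R) \in Lfun mu +oo%E.
Proof.
move=> [mg gM]; have M0 : 0 <= M by apply: le_trans (gM point).
rewrite inE; apply/andP; split; rewrite inE//=.
exact: le_lt_trans (Lnorm_infty_le mu M0 gM) (ltry _).
Qed.

Lemma heat_op_hoelder t x y g M : 0 < t -> bounded_measurable g M ->
  `|heat_op mu p t g x - heat_op mu p t g y| <=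
    C * (mdist x y `^ kappa / t `^ (kappa / dW)) * M.
Proof.
move=> t0 bg; have [mg gM] := bg.
have M0 : 0 <= M by apply: le_trans (gM point).
rewrite -lee_fin; apply: (le_trans (BE x y t0 (bounded_Lfun_infty bg))).
rewrite [leRHS]EFinM; apply: lee_wpmul2l; last exact: Lnorm_infty_le.
by rewrite lee_fin mulr_ge0 ?divr_ge0 ?powR_ge0// ltW.
Qed.

Lemma heat_op_continuous t g M : 0 < t -> bounded_measurable g M ->
  continuous (heat_op mu p t g).
Proof.
move=> t0 bg x; apply/cvgrPdist_le => e e0.
have M0 : 0 <= M by case: bg => _ gM; apply: le_trans (gM point).
set A := C * M / t `^ (kappa / dW).
have A0 : 0 <= A by rewrite divr_ge0 ?powR_ge0// mulr_ge0// ltW.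
pose B := e / (A + 1).
have B0 : 0 < B by rewrite divr_gt0// ltr_wpDl.
have d0 : 0 < B `^ kappa^-1 by rewrite powR_gt0.
apply: filterS (nbhsx_ballx x _ d0) => y; rewrite ballEmdist /= => xy.
apply: (le_trans (heat_op_hoelder x y t0 bg)).
have -> : C * (mdist x y `^ kappa / t `^ (kappa / dW)) * M = A * mdist x y `^ kappa.
  by rewrite /A; ring.
apply: (@le_trans _ _ (A * B)).
  rewrite ler_wpM2l// -[leRHS](powRr1 (ltW B0)).
  rewrite -(mulVf (lt0r_neq0 kappa_gt0)) powRrM.
  by apply: ge0_ler_powR; rewrite ?nnegrE ?mdist_ge0 ?powR_ge0 ?(ltW kappa_gt0) ?(ltW xy).
rewrite /B mulrCA ler_piMr ?(ltW e0)// ler_pdivrMr ?mul1r ?lerDl//.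
by rewrite ltr_wpDl.
Qed.

Lemma heat_op_bounded_measurable t g M : 0 < t -> bounded_measurable g M ->
  bounded_measurable (heat_op mu p t g) (K * M).
Proof.
move=> t0 bg; split; last by move=> x; exact: heat_op_bounded.
by apply: continuous_borel_measurable; exact: heat_op_continuous bg.
Qed.

Lemma heat_op_cvg t x (g_ : nat -> X -> R) g M : 0 < t ->
  (forall n, bounded_measurable (g_ n) M) -> (forall y, g_ ^~ y @ \oo --> g y) ->
  heat_op mu p t (g_ n) x @[n --> \oo] --> heat_op mu p t g x.
Proof.
move=> t0 bg gg.
apply: (@cvg_Rintegral _ _ _ mu _ _ (fun y => M * p t x y)).
- by move=> n; apply: measurable_funM; [exact: p_meas|case: (bg n)].
- by move=> y; apply: cvgM; [exact: cvg_cst|exact: gg].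
- by have /(integrableZl measurableT M) := heat_kernel_integrable x t0.
- move=> n y; rewrite normrM ger0_norm ?p_ge0// mulrC ler_wpM2r ?p_ge0//.
  by case: (bg n).
Qed.

Variable P : R -> (X -> R) -> X -> R.
Hypothesis mu_support : full_support mu.
Hypothesis ball_lty : forall x (r : R), (mu (ball x r) < +oo)%E.
Hypothesis P_kernel : forall t g, 0 < t -> L2 mu g ->
  {ae mu, forall x, P t g x = heat_op mu p t g x}.
Hypothesis P_L2 : forall t g, 0 < t -> L2 mu g -> L2 mu (P t g).
Hypothesis P_add : forall s t g, 0 < s -> 0 < t -> L2 mu g ->
  {ae mu, forall x, P (s + t) g x = P s (P t g) x}.

Let L2_measurable g : L2 mu g -> measurable_fun setT (g : borel X -> R).
Proof. by rewrite /L2 /= inE => /andP[/[!inE]]. Qed.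

Lemma bounded_ball_L2 g M x (r : R) : bounded_measurable g M ->
  (forall y, ~ ball x r y -> g y = 0) -> L2 mu g.
Proof.
move=> [mg gM] g0; rewrite /L2 /= inE; apply/andP; split; rewrite inE//=.
rewrite /finite_norm unlock /Lnorm; apply: poweR_lty.
have M0 : 0 <= M by apply: le_trans (gM point).
have mB := measurable_mball x r.
apply: (@le_lt_trans _ _ (\int[mu]_y ((M `^ 2)%:E * (\1_(ball x r) y)%:E))%E).
  apply: ge0_le_integral => //.
  - by move=> y _; exact: poweR_ge0.
  - apply/measurable_EFinP/(measurableT_comp (measurable_powR _)).
    exact: measurableT_comp.
  - by apply: measurable_funeM; apply/measurable_EFinP; exact: measurable_indic.
  - move=> y _; rewrite /= -EFinM lee_fin indicE.
    have [yB|yB] := boolP (y \in (ball x r : set X)).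
      by rewrite mulr1; apply: ge0_ler_powR => //; rewrite nnegrE.
    by move: yB; rewrite notin_setE => yB; rewrite g0 ?normr0 ?powR0 ?mulr0.
rewrite ge0_integralZl//.
- rewrite integral_indic// setIT.
  by apply: lte_mul_pinfty; rewrite ?lee_fin ?powR_ge0 ?ball_lty.
- by apply/measurable_EFinP; exact: measurable_indic.
- by rewrite lee_fin powR_ge0.
Qed.

(** The semigroup law holds almost everywhere on [L2]; for a bounded function both
    sides are continuous, hence equal. *)
Lemma heat_op_add_L2 s t x g M : 0 < s -> 0 < t -> bounded_measurable g M ->
  L2 mu g -> heat_op mu p s (heat_op mu p t g) x = heat_op mu p (s + t) g x.
Proof.
move=> s0 t0 bg g2.
have st0 : 0 < s + t by rewrite addr_gt0.
have btg := heat_op_bounded_measurable t0 bg.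
suff : heat_op mu p s (heat_op mu p t g) = heat_op mu p (s + t) g.
  by move=> /(congr1 (fun h => h x)).
apply: (ae_continuous_eq mu_support).
- exact: heat_op_continuous btg.
- exact: heat_op_continuous bg.
have Pt2 := P_L2 t0 g2.
have mPt := L2_measurable Pt2.
have hE z : heat_op mu p s (P t g) z = heat_op mu p s (heat_op mu p t g) z.
  congr fine; apply: ae_eq_integral => //.
  - by apply/measurable_EFinP/measurable_funM => //; exact: p_meas.
  - by apply/measurable_EFinP/measurable_funM; [exact: p_meas|case: btg].
  - have Pg := P_kernel t0 g2.
    by apply: (@filterS _ _ (ae_filter_ringOfSetsType mu) _ _ _ Pg) => y /= ->.
have h1 := P_kernel st0 g2; have h2 := P_add s0 t0 g2; have h3 := P_kernel s0 Pt2.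
apply: (@filterS3 _ _ (ae_filter_ringOfSetsType mu) _ _ _ _ _ h1 h2 h3) => z <- ->.
by rewrite hE.
Qed.

(** Truncation to balls centred at a fixed point reduces to [L2]. *)
Lemma heat_op_add s t x g M : 0 < s -> 0 < t -> bounded_measurable g M ->
  heat_op mu p s (heat_op mu p t g) x = heat_op mu p (s + t) g x.
Proof.
move=> s0 t0 bg; have st0 : 0 < s + t by rewrite addr_gt0.
have [mg gM] := bg.
have M0 : 0 <= M by apply: le_trans (gM point).
pose g_ n y := g y * \1_(ball (point : X) n%:R) y.
have bg_ n : bounded_measurable (g_ n) M.
  split; first apply: measurable_funM => //.
    by apply: measurable_indic; exact: measurable_mball.
  move=> y; rewrite /g_ indicE normrM; case: (y \in _); rewrite ?normr1 ?mulr1//.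
  by rewrite normr0 mulr0.
have g_g y : g_ ^~ y @ \oo --> g y.
  apply: cvg_near_cst; exists (Num.bound (mdist point y)) => // n /= hn.
  rewrite /g_ indicE mem_set ?mulr1// ballEmdist /=.
  apply: (lt_le_trans (archi_boundP _)); first exact: mdist_ge0.
  by rewrite ler_nat.
have g2 n : L2 mu (g_ n).
  apply: (bounded_ball_L2 (bg_ n) (x := point) (r := n%:R)) => y yB.
  by rewrite /g_ indicE memNset ?mulr0.
have c1 : heat_op mu p (s + t) (g_ n) x @[n --> \oo] --> heat_op mu p (s + t) g x.
  exact: heat_op_cvg bg_ g_g.
have c2 : heat_op mu p s (heat_op mu p t (g_ n)) x @[n --> \oo] -->
    heat_op mu p s (heat_op mu p t g) x.
  apply: (@heat_op_cvg s x _ _ (K * M)) => // [n|y].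
    exact: heat_op_bounded_measurable.
  exact: heat_op_cvg bg_ g_g.
have E : (fun n => heat_op mu p s (heat_op mu p t (g_ n)) x) =
    (fun n => heat_op mu p (s + t) (g_ n) x).
  by apply/funext => n; exact: heat_op_add_L2 (bg_ n) (g2 n).
by move: c2; rewrite E => c2; exact: (cvg_unique _ c2 c1).
Qed.

Let bounded_cst1 : bounded_measurable (cst 1 : X -> R) 1.
Proof. by split=> // x; rewrite normr1. Qed.

(** Integrating [p h x y * (g y - g x)] in [y], the moment of order [kappa] of the
    heat kernel is of order [h `^ (kappa / dW)]. *)
Lemma heat_op_oscillation h x g M A : 0 < h -> 0 <= A ->
  bounded_measurable g M ->
  (forall y, `|g y - g x| <= A * mdist x y `^ kappa) ->
  `|heat_op mu p h g x - g x * heat_op mu p h (cst 1) x|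
    <= A * h `^ (kappa / dW) * K.
Proof.
move=> h0 A0 bg gA.
have i1 := heat_op_integrable x h0 bounded_cst1.
have ig := heat_op_integrable x h0 bg.
have ig1 : mu.-integrable setT (fun y => (g x * (p h x y * 1))%:E).
  by have := integrableZl measurableT (g x) i1.
rewrite /heat_op -RintegralZl// -RintegralB//.
apply: le_trans (le_normr_Rintegral _ _) _ => //.
  by have := integrableB measurableT ig ig1.
apply: (@le_trans _ _ (\int[mu]_y (A * h `^ (kappa / dW) * (p h x y * weight h x y)))).
  apply: le_Rintegral => //.
  - by have /integrable_norm := integrableB measurableT ig ig1; exact.
  - by have /(integrableZl measurableT (A * h `^ (kappa / dW))) := weighted_integrable x h0.
  - move=> y _; rewrite mulr1 (mulrC (g x)) -mulrBr normrM ger0_norm ?p_ge0//.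
    rewrite mulrCA ler_wpM2l ?p_ge0// (le_trans (gA y))// -mulrA ler_wpM2l//.
    exact: mdist_le_weight.
rewrite RintegralZl//; last exact: weighted_integrable.
by rewrite ler_wpM2l ?mulr_ge0 ?powR_ge0 ?weighted_le.
Qed.

(** The values [u_((n + 1) s)(x)] of [u_t = P_t 1] form a sequence bounded between
    two positive constants and geometric of ratio [u_s(x)] up to an error of order
    [n `^ (- kappa / dW)]. *)
Lemma heat_op_conservative s x : 0 < s -> heat_op mu p s (cst 1) x = 1.
Proof.
move=> s0; pose u t := heat_op mu p t (cst 1).
have ub t : 0 < t -> m <= u t x <= K.
  move=> t0; apply/andP; split; last first.
    by have := heat_op_bounded x t0 bounded_cst1; rewrite mulr1; exact: le_trans (ler_norm _).
  rewrite -lee_fin /u /heat_op fineK.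
    by under eq_integral do rewrite mulr1; exact: p_mass.
  exact: integrable_fin_num (heat_op_integrable x t0 bounded_cst1).
have ns0 n : 0 < n.+1%:R * s by rewrite mulr_gt0.
pose q := kappa / dW; have q0 : 0 < q by rewrite divr_gt0.
pose e (n : nat) := C * K * `|harmonic n : R| `^ q.
apply: (@quasi_geometric_ratio_eq1 R (fun n => u (n.+1%:R * s) x) e _ m K m_gt0).
- by move=> n; exact: ub.
- rewrite -[X in _ --> X](mulr0 (C * K)); apply: cvgM; first exact: cvg_cst.
  exact: cvg_powR_norm0 q0 cvg_harmonic.
- move=> n; have bu := heat_op_bounded_measurable (ns0 n) bounded_cst1.
  have A0 : 0 <= C / (n.+1%:R * s) `^ q by rewrite divr_ge0 ?powR_ge0// ltW.
  have uA y : `|heat_op mu p (n.+1%:R * s) (cst 1) y -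
      heat_op mu p (n.+1%:R * s) (cst 1) x| <=
      C / (n.+1%:R * s) `^ q * mdist x y `^ kappa.
    have := heat_op_hoelder y x (ns0 n) bounded_cst1.
    by rewrite metric_sym mulr1 mulrA mulrAC.
  have := heat_op_oscillation s0 A0 bu uA.
  rewrite (heat_op_add _ s0 (ns0 n) bounded_cst1).
  have -> : s + n.+1%:R * s = n.+2%:R * s by rewrite -[n.+2%:R]natr1; ring.
  rewrite (mulrC (heat_op _ _ (n.+1%:R * s) _ _)) => /le_trans; apply.
  rewrite le_eqVlt; apply/orP; left; apply/eqP.
  rewrite /e /q ger0_norm ?invr_ge0// powRM ?(ltW s0)// invfM.
  have -> : (n.+1%:R^-1 : R) `^ q = (n.+1%:R `^ q)^-1.
    by rewrite -powRN -[in LHS]powR_inv1// -powRrM mulN1r.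
  rewrite /q; field; by rewrite !lt0r_neq0 ?powR_gt0.
Qed.

(** [P_(s + h) g = P_h (P_s g)], and by conservativeness [P_h] moves the Hoelder
    continuous function [P_s g] by at most its oscillation at scale
    [h `^ dW^-1]. *)
Lemma heat_op_time_regular s h x g M : 0 < s -> 0 < h -> bounded_measurable g M ->
  `|heat_op mu p (s + h) g x - heat_op mu p s g x| <=
    C * M / s `^ (kappa / dW) * h `^ (kappa / dW) * K.
Proof.
move=> s0 h0 bg; have bsg := heat_op_bounded_measurable s0 bg.
have M0 : 0 <= M by case: bg => _ gM; apply: le_trans (gM point).
have A0 : 0 <= C * M / s `^ (kappa / dW).
  by rewrite divr_ge0 ?powR_ge0// mulr_ge0// ltW.
have gA y : `|heat_op mu p s g y - heat_op mu p s g x| <=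
    C * M / s `^ (kappa / dW) * mdist x y `^ kappa.
  rewrite (le_trans (heat_op_hoelder y x s0 bg))// (metric_sym y).
  by rewrite le_eqVlt; apply/orP; left; apply/eqP; ring.
have := heat_op_oscillation h0 A0 bsg gA.
by rewrite (heat_op_add _ h0 s0 bg) heat_op_conservative// mulr1 (addrC h).
Qed.

Lemma heat_op_time_continuous x g M (s : R) : 0 < s -> bounded_measurable g M ->
  {for s, continuous (fun s => heat_op mu p s g x)}.
Proof.
move=> s0 bg; pose q := kappa / dW; have q0 : 0 < q by rewrite divr_gt0.
have M0 : 0 <= M by case: bg => _ gM; apply: le_trans (gM point).
pose A := C * M / (s / 2) `^ q * K.
have A0 : 0 <= A by rewrite !mulr_ge0 ?invr_ge0 ?powR_ge0// ltW.
(* Away from time 0 the constants of heat_op_time_regular are bounded. *)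
have bound a b : s / 2 <= a -> a < b ->
    `|heat_op mu p b g x - heat_op mu p a g x| <= A * `|b - a| `^ q.
  move=> sa ab; have s20 : 0 < s / 2 by rewrite divr_gt0.
  have a0 : 0 < a by exact: lt_le_trans sa.
  have ba0 : 0 < b - a by rewrite subr_gt0.
  have := heat_op_time_regular x a0 ba0 bg.
  have -> : a + (b - a) = b by ring.
  move=> /le_trans; apply.
  rewrite (ger0_norm (ltW ba0)) -/q /A mulrAC ler_wpM2r ?powR_ge0//.
  rewrite ler_wpM2r// ler_wpM2l ?mulr_ge0 ?(ltW C_gt0)//.
  rewrite lef_pV2 ?posrE ?powR_gt0//.
  by apply: ge0_ler_powR; rewrite ?nnegrE ?(ltW q0) ?(ltW s20) ?(ltW a0).
have cq : A * `|s - s'| `^ q @[s' --> s] --> 0.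
  rewrite -[X in _ --> X](mulr0 A); apply: cvgMl_tmp.
  apply: (cvg_powR_norm0 q0).
  by rewrite -[X in _ --> X](subrr s); apply: cvgB; [exact: cvg_cst|exact: cvg_id].
apply/cvgrPdist_le => e e0.
have s20 : 0 < s / 2 by rewrite divr_gt0.
have H1 : \forall s' \near s, A * `|s - s'| `^ q <= e.
  move/cvgrPdist_le : cq => /(_ e e0); apply: filterS => s'.
  rewrite sub0r normrN; exact: le_trans (ler_norm _).
apply: filterS2 H1 (nbhsx_ballx s (s / 2) s20) => s' H1.
rewrite /ball /= => H2.
have s's : s / 2 <= s' by move: H2; rewrite ltr_norml; lra.
have [ss'|s's'|->] := ltgtP s s'; last by rewrite subrr normr0 ltW.
- have h : s / 2 <= s by lra.
  by rewrite distrC (le_trans (bound _ _ h ss'))// distrC.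
- by rewrite (le_trans (bound _ _ s's s's')).
Qed.

Lemma heat_op_time_measurable x g M : bounded_measurable g M ->
  measurable_fun (`](0 : R), +oo[ : set R) (fun s : R => heat_op mu p s g x).
Proof.
move=> bg; apply: open_continuous_measurable_fun; first exact: interval_open.
move=> s; rewrite inE /= in_itv /= andbT => s0.
exact: heat_op_time_continuous bg.
Qed.

Hypothesis p_sup : forall t : R, 0 < t -> exists B : R, forall x y, p t x y <= B.

Lemma heat_op_integrable_L1 t x g : 0 < t -> (g : borel X -> R) \in Lfun mu 1 ->
  mu.-integrable setT (fun y => (p t x y * g y)%:E).
Proof.
move=> t0 /Lfun1_integrable ig; have [B pB] := p_sup t0.
have /measurable_int/measurable_EFinP mg := ig.
have /(integrableZl measurableT B) ig' := integrable_norm ig.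
apply: (@integrable_dominated _ _ _ mu _ (fun y => B * `|g y|)) => //.
  by apply: measurable_funM => //; exact: p_meas.
by move=> y; rewrite normrM (ger0_norm (p_ge0 x y t0)) ler_wpM2r.
Qed.

(** The truncations of [g] at height [n] are bounded, and their images converge to
    that of [g] at each time by dominated convergence. *)
Lemma heat_op_time_measurable_L1 x g : (g : borel X -> R) \in Lfun mu 1 ->
  measurable_fun (`](0 : R), +oo[ : set R) (fun s : R => heat_op mu p s g x).
Proof.
move=> g1; have /Lfun1_integrable ig := g1.
have /measurable_int/measurable_EFinP mg := ig.
pose g_ n y := g y * \1_[set z | `|g z| <= n%:R] y.
have mA n : measurable ([set z | `|g z| <= n%:R] : set (borel X)).
  rewrite (_ : [set _ | _] =
    setT `&` (fun z : borel X => `|g z|) @^-1` [set u | u <= n%:R]).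
    apply: (measurableT_comp (@normr_measurable R setT) mg) => //.
    by rewrite -set_itvNyc.
  by rewrite setTI.
have mg_ n : measurable_fun setT (g_ n : borel X -> R).
  by apply: measurable_funM => //; exact: measurable_indic.
have bg_ n : bounded_measurable (g_ n) n%:R.
  split=> // y; rewrite /g_ indicE.
  have [/set_mem /= yA|_] := boolP (y \in _); first by rewrite mulr1.
  by rewrite mulr0 normr0.
have g_le n y : `|g_ n y| <= `|g y|.
  by rewrite /g_ indicE normrM; case: (y \in _); rewrite ?normr1 ?mulr1// normr0 mulr0.
have g_g y : g_ ^~ y @ \oo --> g y.
  apply: cvg_near_cst; exists (Num.bound (`|g y|)) => // n /= hn.
  rewrite /g_ indicE mem_set ?mulr1//=.
  by apply/ltW/(lt_le_trans (archi_boundP _)) => //; rewrite ler_nat.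
apply: (@measurable_fun_cvg _ _ _ _ (fun n s => heat_op mu p s (g_ n) x)).
  by move=> n; exact: heat_op_time_measurable (bg_ n).
move=> s /=; rewrite in_itv /= andbT => s0.
apply: (@cvg_Rintegral _ _ _ mu _ _ (fun y => `|p s x y * g y|)).
- by move=> n; apply: measurable_funM => //; exact: p_meas.
- by move=> y; apply: cvgM; [exact: cvg_cst|exact: g_g].
- exact: (integrable_norm (heat_op_integrable_L1 x s0 g1)).
- move=> n y; rewrite (normrM (p s x y) (g_ n y)) (normrM _ (g y)).
  by rewrite ler_wpM2l ?g_le.
Qed.

End heat_operator.

(** * The subordinator *)

Section subordinator.
Context {R : realType}.
Variables (delta : R) (eta : R -> R -> R).
Hypotheses (delta_gt0 : 0 < delta) (eta_density : subordinator_density delta eta).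
Implicit Types (s t l : R).

Local Notation Rpos := (`](0 : R), +oo[%classic : set R).

Lemma subordinator_measurable t : 0 < t -> measurable_fun Rpos (eta t).
Proof.
move=> t0; have [ceta _ _] := eta_density t0.
by apply: subspace_continuous_measurable_fun => //; exact: measurable_itv.
Qed.

Lemma subordinator_ge0 t s : 0 < t -> 0 < s -> 0 <= eta t s.
Proof. by move=> t0; have [_ + _] := eta_density t0; exact. Qed.

Let Rpos_gt0 s : Rpos s -> 0 < s. Proof. by rewrite /= in_itv /= andbT. Qed.

Lemma measurable_expRN l : measurable_fun setT (fun s : R => expR (- (s * l))).
Proof.
apply: measurableT_comp => //; apply: measurableT_comp => //.
exact: measurable_funM.
Qed.

(** Monotone convergence in the Laplace transform along [l = 1 / (n + 1)]. *)
Lemma subordinator_mass t : 0 < t ->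
  (\int[lebesgue_measure]_(s in Rpos) (eta t s)%:E = 1)%E.
Proof.
move=> t0; have [_ _ laplace] := eta_density t0.
have meta := subordinator_measurable t0.
pose l n : R := harmonic n.
have l0 n : 0 < l n by rewrite invr_gt0.
pose g n s := (eta t s * expR (- (s * l n)))%:E.
have c1 : (\int[lebesgue_measure]_(s in Rpos) g n s)%E @[n --> \oo] -->
    (\int[lebesgue_measure]_(s in Rpos) (eta t s)%:E)%E.
  have -> : (\int[lebesgue_measure]_(s in Rpos) (eta t s)%:E =
      \int[lebesgue_measure]_(s in Rpos) limn (g^~ s))%E.
    apply: eq_integral => s /set_mem/Rpos_gt0 s0; apply/esym/cvg_lim => //.
    apply: cvg_EFin; first exact: nearW.
    rewrite -[X in _ --> X]mulr1 -expR0 -[X in expR X]oppr0 -(mulr0 s).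
    apply: cvgMl_tmp; apply: continuous_cvg; first exact: continuous_expR.
    by apply: cvgN; apply: cvgMl_tmp; exact: cvg_harmonic.
  apply: cvg_monotone_convergence => //.
  - move=> n; apply/measurable_EFinP; apply: measurable_funM => //.
    by apply: measurable_funTS; exact: measurable_expRN.
  - by move=> n s /Rpos_gt0 s0; rewrite lee_fin mulr_ge0 ?expR_ge0 ?subordinator_ge0.
  - move=> s /Rpos_gt0 s0 a b ab; rewrite lee_fin ler_wpM2l ?subordinator_ge0//.
    by rewrite ler_expR lerN2 ler_wpM2l ?(ltW s0)// lef_pV2 ?posrE// ler_nat ltnS.
apply: (cvg_unique _ c1) => //.
rewrite (_ : (fun n => _) = (fun n => (expR (- (t * l n `^ delta)))%:E)); last first.
  by apply/funext => n; exact: laplace.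
apply: cvg_EFin; first exact: nearW.
rewrite -[X in _ --> X]expR0 -[X in expR X]oppr0 -(mulr0 t).
apply: continuous_cvg; first exact: continuous_expR.
apply: cvgN; apply: cvgMl_tmp.
have -> : (fun n => l n `^ delta) = (fun n => `|l n| `^ delta).
  by apply/funext => n; rewrite ger0_norm// ltW.
exact: cvg_powR_norm0 delta_gt0 (@cvg_harmonic R).
Qed.

(** As the density has mass 1, the left-hand side is
    [1 - expR (- (t * l `^ delta))]. *)
Lemma subordinator_laplace_increment t l : 0 < t -> 0 < l ->
  (\int[lebesgue_measure]_(s in Rpos) (eta t s * (1 - expR (- (s * l))))%:E
    <= (t * l `^ delta)%:E)%E.
Proof.
move=> t0 l0; have [_ _ laplace] := eta_density t0.
have meta := subordinator_measurable t0.
have mexp := measurable_funTS (D := Rpos) (measurable_expRN l).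
have mass := subordinator_mass t0.
have e1 s : 0 < s -> expR (- (s * l)) <= 1.
  by move=> s0; rewrite expR_le1 oppr_le0 mulr_ge0// ltW.
have H : (\int[lebesgue_measure]_(s in Rpos) (eta t s)%:E =
    \int[lebesgue_measure]_(s in Rpos) (eta t s * expR (- (s * l)))%:E +
    \int[lebesgue_measure]_(s in Rpos) (eta t s * (1 - expR (- (s * l))))%:E)%E.
  rewrite -ge0_integralD//=.
  - by apply: eq_integral => s _; rewrite -EFinD -mulrDr addrC subrK mulr1.
  - by move=> s /Rpos_gt0 s0; rewrite lee_fin mulr_ge0 ?expR_ge0 ?subordinator_ge0.
  - by apply/measurable_EFinP; exact: measurable_funM.
  - move=> s /Rpos_gt0 s0; rewrite lee_fin mulr_ge0 ?subordinator_ge0//.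
    by rewrite subr_ge0 e1.
  - by apply/measurable_EFinP; apply: measurable_funM => //; exact: measurable_funB.
move: H; rewrite mass laplace//; set I := (\int[_]_(_ in _) _)%E => H.
have := expR_ge1Dx (- (t * l `^ delta)).
move: H; case: I => [r|//|//]; rewrite -EFinD => -[h]; rewrite lee_fin; lra.
Qed.

End subordinator.

(** * The subordinated heat operator *)

Section subordinated_heat_operator.
Context {R : realType} {X : pmetricType R}.
Variables (mu : {measure set (borel X) -> \bar R}) (p : R -> X -> X -> R).
Variables (dH dW delta A : R) (eta : R -> R -> R).
Hypotheses (mu_sf : sigma_finite setT mu) (A_gt0 : 0 < A).
Hypotheses (delta_gt0 : 0 < delta) (eta_density : subordinator_density delta eta).
Hypothesis p_ge0 : forall (s : R) x y, 0 < s -> 0 <= p s x y.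

Let majorant (s : R) (x y : X) : R :=
  A * mdist x y `^ (- dH) * (1 - expR (- (s * mdist x y `^ (- dW)))).

Hypothesis p_le : forall (s : R) x y, 0 < s -> x != y -> p s x y <= majorant s x y.
Hypothesis p_integrable : forall (s : R) x, 0 < s ->
  mu.-integrable setT (fun y => (p s x y)%:E).
Hypothesis p_conservative : forall (s : R) x, 0 < s -> heat_op mu p s (cst 1) x = 1.

Local Notation Rpos := (`](0 : R), +oo[%classic : set R).

Variables (f : X -> R) (x : X).
Hypothesis f_meas : measurable_fun setT (f : borel X -> R).
Hypothesis pf_integrable : forall s : R, 0 < s ->
  mu.-integrable setT (fun y => (p s x y * f y)%:E).
Hypothesis heat_op_meas : measurable_fun Rpos (fun s : R => heat_op mu p s f x).

Implicit Types (s t : R) (y : X).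

Let w y : R := `|f x - f y|.

Let w_ge0 y : 0 <= w y. Proof. exact: normr_ge0. Qed.

Let majorant_ge0 s y : 0 < s -> 0 <= majorant s x y.
Proof.
move=> s0; rewrite !mulr_ge0 ?powR_ge0 ?(ltW A_gt0)//.
by rewrite subr_ge0 expR_le1 oppr_le0 mulr_ge0 ?powR_ge0// ltW.
Qed.

Let w_meas : measurable_fun setT (w : borel X -> R).
Proof. by apply: measurableT_comp => //; exact: measurable_funB. Qed.

Let majorant_meas : measurable_fun setT
  (fun z : R * borel X => majorant z.1 x z.2).
Proof.
have md (q : R) : measurable_fun setT (fun z : R * borel X => mdist x z.2 `^ q).
  apply: (measurableT_comp (measurable_powR _)).
  by apply: (measurableT_comp (measurable_mdist x)); exact: measurable_snd.
apply: measurable_funM; first exact: measurable_funM.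
apply: measurable_funB => //; apply: measurableT_comp => //.
by apply: measurableT_comp => //; apply: measurable_funM.
Qed.

(* By conservativeness the difference is the integral of p s x y * (f y - f x);
   the majorant dominates p off the diagonal, and on it f y - f x = 0. *)
Let heat_op_diff_le s : 0 < s ->
  (`|heat_op mu p s f x - f x|%:E <= \int[mu]_y (majorant s x y * w y)%:E)%E.
Proof.
move=> s0; have ip := p_integrable x s0; have ipf := pf_integrable s0.
have ifp : mu.-integrable setT (fun y => (f x * p s x y)%:E).
  by have := integrableZl measurableT (f x) ip.
have E : heat_op mu p s f x - f x = \int[mu]_y (p s x y * f y - f x * p s x y).
  rewrite RintegralB// RintegralZl//; congr (_ - _).
  rewrite -[LHS]mulr1 -(p_conservative x s0); congr (_ * _).
  by apply: eq_Rintegral => y _; rewrite mulr1.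
have iD : mu.-integrable setT (fun y => (p s x y * f y - f x * p s x y)%:E).
  by have := integrableB measurableT ipf ifp.
have mD := measurable_int mu iD.
rewrite E; apply: (@le_trans _ _ (\int[mu]_y `|(p s x y * f y - f x * p s x y)%:E|)%E).
  rewrite (EFin_normr_Rintegral measurableT iD).
  exact: (le_abse_integral mu measurableT mD).
apply: ge0_le_integral => //.
- exact: (measurableT_comp (@abse_measurable R setT) mD).
- apply/measurable_EFinP; apply: measurable_funM => //.
  exact: (measurableT_comp majorant_meas (measurable_pair1 s)).
- move=> y _; rewrite /= lee_fin (mulrC (f x)) -mulrBr normrM (ger0_norm (p_ge0 _ _ _))//.
  rewrite distrC; have [->|xy] := eqVneq y x.
    by rewrite /w subrr normr0 !mulr0.
  by rewrite ler_wpM2r// p_le// eq_sym.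
Qed.

(* Extending the density by zero lets Tonelli's theorem be applied on R * X. *)
Let etaR t : R -> R := eta t \_ Rpos.

Let etaRE t s : etaR t s = if 0 < s then eta t s else 0.
Proof.
rewrite /etaR patchE; have [s0|s0] := ltP 0 s.
  by rewrite mem_set//= in_itv /= s0.
by rewrite memNset//= in_itv /= andbT ltNge s0.
Qed.

Let etaR_ge0 t s : 0 < t -> 0 <= etaR t s.
Proof.
move=> t0; rewrite etaRE; case: ifPn => // s0.
exact: (subordinator_ge0 eta_density t0 s0).
Qed.

Let integrand t (z : R * borel X) : \bar R :=
  (etaR t z.1 * (majorant z.1 x z.2 * w z.2))%:E.

Let integrand_ge0 t z : 0 < t -> (0 <= integrand t z)%E.
Proof.
move=> t0; rewrite lee_fin; have [s0|s0] := ltP 0 z.1.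
  apply: mulr_ge0; first exact: etaR_ge0.
  by apply: mulr_ge0; [exact: majorant_ge0|exact: w_ge0].
by rewrite etaRE ltNge s0 mul0r.
Qed.

Let integrand_meas t : 0 < t -> measurable_fun setT (integrand t).
Proof.
move=> t0; have me : measurable_fun setT (etaR t).
  apply/(measurable_restrictT _ (measurable_itv _)).
  exact: (subordinator_measurable eta_density t0).
apply/measurable_EFinP; apply: measurable_funM.
  exact: (measurableT_comp me measurable_fst).
by apply: measurable_funM => //; exact: (measurableT_comp w_meas measurable_snd).
Qed.

Let integral_time_le t y : 0 < t ->
  (\int[lebesgue_measure]_s integrand t (s, y) <=
    (A * t)%:E * (w y / mdist x y `^ (dH + delta * dW))%:E)%E.
Proof.
move=> t0; have [<-|xy] := eqVneq x y.
  rewrite (_ : (fun s => _) = cst 0%E); last first.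
    by apply/funext => s; rewrite /integrand /= /w subrr normr0 !mulr0.
  rewrite integral_cst// mul0e mule_ge0// lee_fin.
    by rewrite mulr_ge0// ltW.
  by rewrite mulr_ge0 ?invr_ge0 ?powR_ge0.
have d0 : 0 < mdist x y by rewrite mdist_gt0.
have l0 : 0 < mdist x y `^ (- dW) by rewrite powR_gt0.
have b0 : 0 <= A * mdist x y `^ (- dH) * w y.
  by rewrite !mulr_ge0 ?powR_ge0// ltW.
have -> : (\int[lebesgue_measure]_s integrand t (s, y) =
    \int[lebesgue_measure]_(s in Rpos)
     ((A * mdist x y `^ (- dH) * w y)%:E *
      (eta t s * (1 - expR (- (s * mdist x y `^ (- dW)))))%:E))%E.
  rewrite [RHS]integral_mkcond; apply: eq_integral => s _.
  rewrite /integrand etaRE /= patchE; have [s0|s0] := ltP 0 s; last first.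
    by rewrite mul0r memNset//= in_itv /= andbT ltNge s0.
  rewrite mem_set; last by rewrite /= in_itv /= s0.
  by rewrite -EFinM; congr EFin; rewrite /majorant; ring.
rewrite ge0_integralZl//; last 2 first.
- apply/measurable_EFinP; apply: measurable_funM.
    exact: (subordinator_measurable eta_density t0).
  apply: measurable_funB => //; apply: measurable_funTS; exact: measurable_expRN.
- move=> s /=; rewrite in_itv /= andbT => s0.
  rewrite lee_fin mulr_ge0 ?(subordinator_ge0 eta_density)//.
  by rewrite subr_ge0 expR_le1 oppr_le0 mulr_ge0 ?ltW.
apply: (@le_trans _ _ ((A * mdist x y `^ (- dH) * w y)%:E *
    (t * (mdist x y `^ (- dW)) `^ delta)%:E)%E).
  by apply: lee_wpmul2l => //; exact: subordinator_laplace_increment.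
rewrite -!EFinM lee_fin -powRrM powRN mulNr powRN powRD; last first.
  by rewrite (lt0r_neq0 d0) implybT.
rewrite invfM (mulrC delta dW) le_eqVlt; apply/orP; left; apply/eqP; ring.
Qed.

(** When the right-hand side is finite, Tonelli's theorem makes the integrand
    [phi s = eta t s * (heat_op mu p s f x - f x)] integrable in time, which is
    what allows [f x] to be taken out of the integral defining [sub_heat_op]. *)
Lemma sub_heat_op_diff_le t : 0 < t ->
  (`|sub_heat_op mu p eta t f x - f x|%:E <=
    (A * t)%:E * \int[mu]_y (`|f x - f y| / mdist x y `^ (dH + delta * dW))%:E)%E.
Proof.
move=> t0; set G := (\int[mu]_y _)%E.
have [Gy|Gfin] := eqVneq G +oo%E.
  by rewrite Gy gt0_muley ?leey// lte_fin mulr_gt0.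
have mG : measurable_fun [set: borel X]
    (fun y => (w y / mdist x y `^ (dH + delta * dW))%:E).
  apply/measurable_EFinP; apply: measurable_funM => //.
  rewrite (_ : (fun y : borel X => _) = fun y => mdist x y `^ (- (dH + delta * dW))).
    by apply: (measurableT_comp (measurable_powR _)); exact: measurable_mdist.
  by apply/funext => y; rewrite powRN.
(* Integrating in time first produces the kernel of the right-hand side. *)
have tonelli := @fubini_tonelli _ _ _ _ R lebesgue_measure (sigma_finite_pack mu_sf)
  (integrand t) (integrand_meas t0) (fun z => integrand_ge0 z t0).
have bound : (\int[lebesgue_measure]_s \int[mu]_y integrand t (s, y) <=
    (A * t)%:E * G)%E.
  rewrite [leLHS]tonelli /G -ge0_integralZl//; last 2 first.
  - by move=> y _; rewrite lee_fin mulr_ge0 ?invr_ge0 ?powR_ge0.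
  - by rewrite lee_fin mulr_ge0// ltW.
  apply: ge0_le_integral => //.
  - by move=> y _; apply: integral_ge0 => s _; exact: integrand_ge0.
  - exact (@measurable_fun_fubini_tonelli_G _ _ _ _ R lebesgue_measure
      (integrand t) (integrand_meas t0) (fun z => integrand_ge0 z t0)).
  - exact: measurable_funeM.
  - by move=> y _; exact: integral_time_le.
have mRpos : measurable (Rpos : set (measurableTypeR R)) by exact: measurable_itv.
have RposP s : Rpos s -> 0 < s by rewrite /= in_itv /= andbT.
have meta := subordinator_measurable eta_density t0.
pose phi s : R := eta t s * (heat_op mu p s f x - f x).
pose H s := (\int[mu]_y integrand t (s, y))%E.
have mH : measurable_fun setT H.
  exact (@measurable_fun_fubini_tonelli_F _ _ _ _ R (sigma_finite_pack mu_sf)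
      (integrand t) (integrand_meas t0) (fun z => integrand_ge0 z t0)).
have H0 s : (0 <= H s)%E by apply: integral_ge0 => y _; exact: integrand_ge0.
have mphi : measurable_fun Rpos phi.
  by apply: measurable_funM => //; apply: measurable_funB.
have phiH s : Rpos s -> (`|(phi s)%:E| <= H s)%E.
  move=> /RposP s0; have eta0 := subordinator_ge0 eta_density t0 s0.
  rewrite /phi /H /integrand /= etaRE s0.
  under eq_integral do rewrite EFinM.
  rewrite ge0_integralZl//; last 2 first.
  - apply/measurable_EFinP; apply: measurable_funM => //.
    exact: (measurableT_comp majorant_meas (measurable_pair1 s)).
  - move=> y _; rewrite lee_fin; apply: mulr_ge0; last exact: w_ge0.
    exact: majorant_ge0.
  rewrite normrM (ger0_norm eta0) EFinM; apply: lee_wpmul2l; last exact: heat_op_diff_le.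
  by rewrite lee_fin.
have int_phi : (\int[lebesgue_measure]_(s in Rpos) `|(phi s)%:E| <= (A * t)%:E * G)%E.
  apply: le_trans bound.
  apply: (@le_trans _ _ (\int[lebesgue_measure]_(s in Rpos) H s)%E); last first.
    exact: ge0_subset_integral.
  apply: ge0_le_integral => //.
  - by apply: measurableT_comp => //; exact/measurable_EFinP.
  - exact: measurable_funTS.
have G0 : (0 <= G)%E.
  by apply: integral_ge0 => y _; rewrite lee_fin mulr_ge0 ?invr_ge0 ?powR_ge0.
have iphi : lebesgue_measure.-integrable Rpos (EFin \o phi).
  apply/integrableP; split; first exact/measurable_EFinP.
  apply: (le_lt_trans int_phi).
  rewrite lte_mul_pinfty ?lee_fin ?mulr_ge0 ?(ltW A_gt0) ?(ltW t0)//.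
  by rewrite ltey.
have mass := subordinator_mass delta_gt0 eta_density t0.
have ieta : lebesgue_measure.-integrable Rpos (EFin \o eta t).
  apply/integrableP; split; first exact/measurable_EFinP.
  rewrite (_ : (\int[_]_(_ in _) _)%E = 1%E) ?ltry// -mass.
  apply: eq_integral => s /set_mem/RposP s0 /=.
  by rewrite ger0_norm// (subordinator_ge0 eta_density).
have ietaf : lebesgue_measure.-integrable Rpos (EFin \o (fun s => eta t s * f x)).
  have := integrableZr mRpos (f x) ieta; exact.
have -> : sub_heat_op mu p eta t f x - f x = \int[lebesgue_measure]_(s in Rpos) phi s.
  rewrite /sub_heat_op (_ : \int[_]_(_ in _) _ =
      \int[lebesgue_measure]_(s in Rpos) (phi s + eta t s * f x)); last first.
    by apply: eq_Rintegral => s _; rewrite /phi -mulrDr subrK.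
  rewrite RintegralD// RintegralZr// [X in _ + X * _](_ : _ = 1) ?mul1r ?addrK//.
  by rewrite /Rintegral mass.
apply: le_trans int_phi; rewrite (EFin_normr_Rintegral mRpos iphi).
by apply: le_abse_integral => //; exact/measurable_EFinP.
Qed.

End subordinated_heat_operator.

(** * The estimate in L1 *)

Theorem theorem4p9 (R : realType) (X : pmetricType R)
  (mu : {measure set (borel X) -> \bar R})
  (E : (X -> R) -> (X -> R) -> R) (F : set (X -> R))
  (P : R -> (X -> R) -> X -> R) (p : R -> X -> X -> R)
  (dH dW kappa delta : R) (eta : R -> R -> R)
  (locally_compactX : locally_compact [set: X])
  (mu_radon : radon_measure mu)
  (mu_support : full_support mu)
  (form : dirichlet_form mu E F)
  (semigroup : heat_semigroup mu E F P)
  (A1 : relatively_compact_balls X)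
  (dH_gt0 : 0 < dH)
  (A2 : ahlfors_regular mu dH)
  (A3 : regular_form mu E F /\ strongly_local_form mu E F)
  (kernel : continuous_heat_kernel mu p P)
  (dW_ge2 : 2 <= dW)
  (HK : heat_kernel_estimates mu p dH dW)
  (kappa_gt0 : 0 < kappa) (kappa_lt : kappa < dW)
  (kappaE : (dW - kappa)%:E =
    ereal_sup [set lambda%:E | lambda in
      [set lambda : R | 0 < lambda /\ contains_nonconstant mu (KS mu lambda 1)]])
  (BE : bakry_emery mu p dW kappa)
  (delta_gt0 : 0 < delta) (delta_lt1 : delta < 1)
  (eta_density : subordinator_density delta eta)
  (alpha1E : critical_exponent1 mu p eta = 1%E) :
  exists2 C : R, 0 < C &
    forall (f : X -> R) (t : R), besov mu p eta 1 1 f -> 0 < t ->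
      ('N[mu]_1[EFin \o (fun x => sub_heat_op mu p eta t f x - f x)%R] <=
       (C * t)%:E *
       \int[mu]_x \int[mu]_y
         (`|f x - f y| / mdist x y `^ (dH + delta * dW))%:E)%E.
Proof.
have pcont (t : R) : 0 < t -> continuous (fun z : X * X => p t z.1 z.2).
  by move=> t0; have [] := kernel t t0.
have [c3 [c4 [c5 [c6 [c30 c40 c50 _ pE]]]]] :=
  heat_kernel_estimates_everywhere dW_ge2 A2 mu_support pcont HK.
have [A A0 sgA] := sub_gaussian_le_laplace (X := X) dH_gt0 dW_ge2 c30 c40.
have [K K0 p_moment] :=
  heat_kernel_moment dH_gt0 dW_ge2 A2 mu_support pcont HK (ltW kappa_gt0).
have [m m0 p_mass] :=
  heat_kernel_mass_lower_bound dW_ge2 A2 mu_support pcont HK.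
have dW_gt0 : 0 < dW by apply: lt_le_trans dW_ge2.
have [C C0 {}BE] := BE.
have p_ge0 (t : R) x y : 0 < t -> 0 <= p t x y.
  move=> t0; have /andP[+ _] := pE t x y t0; apply: le_trans.
  exact/sub_gaussian_ge0/ltW.
have p_meas (t : R) x : 0 < t -> measurable_fun setT (p t x : borel X -> R).
  by move=> t0; exact: (measurable_heat_kernel pcont x t0).
have p_sup (t : R) : 0 < t -> exists B : R, forall x y, p t x y <= B.
  move=> t0; exists (c3 * t `^ (- dH / dW)) => x y.
  have /andP[_ pu] := pE t x y t0; apply: (le_trans pu).
  by apply: sub_gaussian_le_diag => //; exact: ltW.
have p_le (s : R) x y : 0 < s -> x != y -> p s x y <=
    A * mdist x y `^ (- dH) * (1 - expR (- (s * mdist x y `^ (- dW)))).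
  by move=> s0 xy; have /andP[_ pu] := pE s x y s0; apply: le_trans pu (sgA _ _ _ s0 xy).
have [[P_L2 _ _ P_add _] _] := semigroup.
have P_kernel (t : R) g : 0 < t -> L2 mu g ->
    {ae mu, forall x, P t g x = heat_op mu p t g x}.
  by move=> t0; have [_] := kernel t t0; exact.
have ball_lty x r := mu_ball_lty A2 x r.
have conservative (s : R) x : 0 < s -> heat_op mu p s (cst 1) x = 1.
  exact: (heat_op_conservative dW_gt0 kappa_gt0 m0 C0 p_ge0 p_meas p_moment p_mass
    BE mu_support ball_lty P_kernel P_L2 P_add).
exists A => // f t [f1 _] t0.
have /Lfun1_integrable/(measurable_int mu)/measurable_EFinP f_meas := f1.
rewrite Lnorm1; apply: ge0_le_integralZ.
- by rewrite mulr_gt0.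
- by move=> x; exact: abse_ge0.
- by move=> x; apply: integral_ge0 => y _; rewrite lee_fin divr_ge0 ?powR_ge0.
move=> x /=.
apply: (sub_heat_op_diff_le (ahlfors_sigma_finite A2) A0 delta_gt0 eta_density
  p_ge0 p_le _ conservative f_meas _ _ t0).
- by move=> s z s0; exact: (heat_kernel_integrable kappa_gt0 p_ge0 p_meas p_moment).
- by move=> s s0; exact: (heat_op_integrable_L1 p_ge0 p_meas p_sup _ s0 f1).
- exact: (heat_op_time_measurable_L1 dW_gt0 kappa_gt0 m0 C0 p_ge0 p_meas p_moment
    p_mass BE mu_support ball_lty P_kernel P_L2 P_add p_sup x f1).
Qed.
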